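(* Let $n\ge m\ge 1$ be integers, let $M_1,\dots,M_m>0$ be real numbers, let $0<\lambda_1<\lambda_2<\cdots<\lambda_m$ be real numbers and let $t_1,\dots,t_m$ be positive integers with $\sum_{i=1}^m t_i=n$. If $t_i\le i$ for each $i=1,\dots,m$, then there exist real numbers $m_j>0$, $k_j>0$, $b_j\ge0$ ($j=1,\dots,n$) and $m$ distinct indices $i_1,\dots,i_m\in\{1,\dots,n\}$ such that $m_{i_l}=M_l$ for $l=1,\dots,m$ and $$\prod_{i=1}^{m}(\lambda-\lambda_i)^{t_i}\ \Big|\ \det\big(\boldsymbol{K}-\lambda(\boldsymbol{M}+\boldsymbol{B})\big)$$ (divisibility of real polynomials in $\lambda$), where $\boldsymbol{M},\boldsymbol{K},\boldsymbol{B}$ are the $n\times n$ matrices associated with $(m_j,k_j,b_j)_{j=1}^n$ as in the context.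
   Context: For real numbers $m_j>0$ (masses), $k_j>0$ (spring stiffnesses), $b_j\ge 0$ (inertances), $j=1,\dots,n$, define $n\times n$ real matrices as follows. $\boldsymbol{M}=\mathrm{diag}\{m_1,\dots,m_n\}$. $\boldsymbol{K}$ is the symmetric tridiagonal matrix with diagonal entries $\boldsymbol{K}_{jj}=k_j+k_{j+1}$ for $1\le j\le n-1$, $\boldsymbol{K}_{nn}=k_n$, and off-diagonal entries $\boldsymbol{K}_{j,j+1}=\boldsymbol{K}_{j+1,j}=-k_{j+1}$ for $1\le j\le n-1$ (all other entries zero). $\boldsymbol{B}$ is the symmetric tridiagonal matrix defined in the same way with $b_j$ in place of $k_j$: $\boldsymbol{B}_{jj}=b_j+b_{j+1}$ for $1\le j\le n-1$, $\boldsymbol{B}_{nn}=b_n$, $\boldsymbol{B}_{j,j+1}=\boldsymbol{B}_{j+1,j}=-b_{j+1}$. *)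

(* Defs.v *)
From HB Require Import structures.
From mathcomp Require Import all_boot all_order all_algebra.
From mathcomp Require Import reals.

Set Implicit Arguments.
Unset Strict Implicit.
Unset Printing Implicit Defensive.

Import Order.TTheory GRing.Theory Num.Theory.
Local Open Scope ring_scope.

(* Indices are 0-based: [k i] is the coefficient written k_(i+1) on paper.    *)
(* On the diagonal, [insub i.+1 : option 'I_n] is [None] exactly for the last *)
(* index, where the entry is k_n instead of k_j + k_(j+1).                    *)
Definition chain_mx (R : realType) (n : nat) (k : 'I_n -> R) : 'M[R]_n :=
  \matrix_(i < n, j < n)
    if i == j then
      if (insub i.+1 : option 'I_n) is Some i' then k i + k i' else k i
    else if j == i.+1 :> nat then - k j
    else if i == j.+1 :> nat then - k i
    else 0.

Definition mass_mx (R : realType) (n : nat) (m : 'I_n -> R) : 'M[R]_n :=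
  diag_mx (\row_(j < n) m j).

(* det (K - lambda (M + B)) as a polynomial, with lambda := 'X. *)
Definition chain_charpoly (R : realType) (n : nat) (m k b : 'I_n -> R) :
    {poly R} :=
  \det (map_mx polyC (chain_mx k)
        - 'X *: map_mx polyC (mass_mx m + chain_mx b)).

(* Main.v *)
(* The inertial links allow eigenvalues to be added one at a time.  A chain is  *)
(* described by the pair (N, Q) of polynomials such that Q is its              *)
(* characteristic polynomial and - 'X * N / Q is the dynamic stiffness of its  *)
(* first link in series with the rest, up to a common factor E collecting      *)
(* the repeated eigenvalues.                                                   *)
(*   A link whose stiffness vanishes at nu, put in front of a chain with       *)
(* N(nu) = 0, multiplies E by nu - 'X; when that link is very stiff, it leaves *)
(* N and Q almost unchanged.  A mass and a wall link that resonate near la,    *)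
(* both very large, add the root la to Q and almost do not move the other      *)
(* roots.  To turn "almost" into exact equalities, one shows by induction that *)
(* all pairs close to a given one (subject to one linear constraint when the   *)
(* masses are prescribed) are realized by chains: a perturbed pair is          *)
(* dismantled from the wall, the roots of the polynomials depending            *)
(* continuously on it.  The perturbation needed to hit la exactly can then be  *)
(* absorbed by the part of the chain built before.                             *)
(*   A blocking link at nu needs N(nu) / Q(nu) < 0 before its mass is added,   *)
(* which is possible just after adding an eigenvalue la < nu.  Adding first    *)
(* the simple eigenvalues in decreasing order and then the multiple ones in    *)
(* increasing order, the last t_i - 1 <= i - 1 eigenvalues added before        *)
(* lambda_i are smaller than lambda_i.  Each addition uses one prescribed      *)
(* mass: the resonating one, or, when blocking links follow, the mass put in   *)
(* front of the wall link, the resonating mass being then free.                *)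

Require Import Defs.
From HB Require Import structures.
From mathcomp Require Import all_boot all_order all_algebra.
From mathcomp Require Import reals.
From mathcomp Require Import all_classical topology normedtype.
From mathcomp Require Import ring lra zify.

Set Implicit Arguments.
Unset Strict Implicit.
Unset Printing Implicit Defensive.

Import Order.TTheory GRing.Theory Num.Theory.
Import numFieldNormedType.Exports.
Local Open Scope ring_scope.

(** * Chains and their characteristic polynomials *)

(** Write (N, Q) for a chain whose stiffness seen from the wall is - 'X * N / Q. A mass m in front
    turns N into N + m Q, and a link s then turns the pair into (s N, s Q - 'X N)
    ([realizable_link]). Two moves build the spectrum.

    Resonance: a mass and a wall link whose mass and inertance add up to 1 / g turn a pair close to
    (N, P) into one whose second component is exactly P * (la - 'X) / g ([perturbed_link]). The
    closeness as g tends to 0 is [pcvg_perturbed]. Blocking: if N vanishes at nu, a link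
    proportional to nu - 'X creates the common factor nu - 'X, which is moved into E
    ([stable_blocking_link]).

    Since the pair really needed is only close to the one at hand, the induction carries [stable]:
    all nearby pairs subject to one equation are realizable. A free mass absorbs that equation
    ([stable_free_mass]); a link is undone by following the root of N at which it vanishes
    ([stable_link]).

    The levels are [stable_wall_mass] (one eigenvalue, no blocking), [stable_blocked_level] (one
    eigenvalue, then blocking at larger ones) and [realizable_wall_mass] (the last one);
    [simple_schedule] and [blocked_schedule] chain them. The bound on the multiplicities makes a
    suitable order exist: [raises_lt] and [count_raises]. *)

Definition tridiag_mx (T : comNzRingType) (n : nat) (a c : nat -> T) : 'M[T]_n :=
  \matrix_(i < n, j < n)
    if i == j then a i
    else if j == i.+1 :> nat then - c j
    else if i == j.+1 :> nat then - c i
    else 0.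

Lemma det_tridiag_mx (T : comNzRingType) n (a c : nat -> T) :
  \det (tridiag_mx n.+2 a c) =
  a 0%N * \det (tridiag_mx n.+1 (a \o succn) (c \o succn))
  - c 1%N ^+ 2 * \det (tridiag_mx n (a \o succn \o succn) (c \o succn \o succn)).
Proof.
rewrite (expand_det_row _ ord0) big_ord_recl big_ord_recl big1 ?addr0; last first.
  by move=> i _; rewrite !mxE /= mul0r.
rewrite !mxE /= /cofactor /= expr0 mul1r expr1 mulN1r mulrN mulNr opprK.
congr (_ * _ + _).
  congr (\det _); apply/matrixP => i j; rewrite !mxE.
  by rewrite (inj_eq lift_inj) /= /bump /= !eqSS.
rewrite (expand_det_col _ ord0) big_ord_recl big1 ?addr0; last first.
  by move=> i _; rewrite !mxE /= mul0r.
rewrite !mxE /= /cofactor /= expr0 mul1r mulNr mulrN mulrA -expr2.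
congr (- (_ * _)).
congr (\det _); apply/matrixP => i j; rewrite !mxE /=.
by rewrite -!val_eqE.
Qed.

(* The elements of a chain, listed from the wall: a triple [(m, k, b)] is a  *)
(* mass together with the link attaching it to its left neighbour.            *)
Definition link {R : realType} (x : R * R * R) : {poly R} :=
  x.1.2%:P - x.2 *: 'X.

Definition mass {R : realType} (x : R * R * R) : R := x.1.1.

(* The first component is the characteristic polynomial of the chain, the     *)
(* second one is the link of the first mass times the characteristic          *)
(* polynomial of the chain whose first link has been cut.                     *)
Fixpoint transfer (R : realType) (L : seq (R * R * R)) : {poly R} * {poly R} :=
  if L is x :: L' then
    let q := (transfer L').2 - mass x *: ('X * (transfer L').1) in
    (q + link x * (transfer L').1, link x * q)
  else (1, 0).

(** The recursion of [transfer] is the three-term recurrence of [det_tridiag_mx]. The default triple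
    makes the link beyond the free end zero. *)
Lemma transfer1E (R : realType) (L : seq (R * R * R)) :
  let x i := nth (0, 0, 0) L i in
  (transfer L).1 =
  \det (tridiag_mx (size L)
          (fun i => link (x i) + link (x i.+1) - mass (x i) *: 'X)
          (fun i => link (x i))).
Proof.
have [n] := ubnP (size L); elim: n L => // n IH [|x [|y L]] /= szL.
- by rewrite det_mx00.
- rewrite det_mx11 mxE /= /link /= scale0r subr0 addr0.
  by rewrite sub0r !mulr1 addrC.
- rewrite det_tridiag_mx /=.
  have := IH (y :: L) szL; rewrite /= => <-.
  have := IH L (ltnW szL); rewrite /= => <-.
  rewrite -!mul_polyC; ring.
Qed.

Lemma chain_charpolyE (R : realType) (L : seq (R * R * R)) :
  let x (i : 'I_(size L)) := nth (0, 0, 0) L i in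
  chain_charpoly (fun i => mass (x i)) (fun i => (x i).1.2) (fun i => (x i).2) =
  (transfer L).1.
Proof.
rewrite /= transfer1E /chain_charpoly; congr (\det _).
apply/matrixP => i j; rewrite !mxE.
case: (eqVneq i j) => [_|nij].
  case: insubP => [u _ /= ->|] /=.
    rewrite /link mulr1n !polyCD mulrDr mulrDr -!mul_polyC; ring.
  rewrite -leqNgt => szi; rewrite [nth _ _ i.+1]nth_default // /link /=.
  rewrite scale0r subr0 mulr1n !polyCD mulrDr -!mul_polyC; ring.
rewrite mulr0n add0r.
case: ifP => _; first by rewrite /link !polyCN -!mul_polyC; ring.
case: ifP => _; first by rewrite /link !polyCN -!mul_polyC; ring.
by rewrite polyC0 mulr0 subr0.
Qed.

(** * Limits of polynomials of bounded degree *)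

Local Open Scope classical_set_scope.

Section PolynomialLimits.
Context {R : realType}.
Implicit Types (p q : {poly R}) (z w : {poly R} * {poly R}).

(** Bounding the sizes keeps the pairs in a finite-dimensional space, where coefficientwise
    closeness makes evaluation and division continuous. *)
Definition poly_ball (d : nat) z (e : R) : set ({poly R} * {poly R}) :=
  [set w : {poly R} * {poly R} | [/\ (size w.1 <= d)%N, (size w.2 <= d)%N &
     forall i, `|z.1`_i - w.1`_i| < e /\ `|z.2`_i - w.2`_i| < e]].

Definition poly_nbhs (d : nat) z : set_system ({poly R} * {poly R}) :=
  filter_from [set e : R | 0 < e] (poly_ball d z).

#[export] Instance poly_nbhs_filter d z : Filter (poly_nbhs d z).
Proof.
apply: filter_from_filter => [|e1 e2 /= e1_gt0 e2_gt0]; first by exists 1 => /=.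
exists (Num.min e1 e2); first by rewrite /= lt_min e1_gt0.
move=> w [sz1 sz2 zw]; split; split=> // i; have [] := zw i;
  by rewrite !lt_min => /andP[? ?] /andP[].
Qed.

Lemma poly_nbhs_self d z (P : set ({poly R} * {poly R})) :
    (size z.1 <= d)%N -> (size z.2 <= d)%N ->
  (\forall w \near poly_nbhs d z, P w) -> P z.
Proof.
move=> sz1 sz2 [e /= e_gt0]; apply; split=> // i.
by rewrite !subrr normr0.
Qed.

Lemma poly_nbhs_interior d z (P : set ({poly R} * {poly R})) :
  (\forall w \near poly_nbhs d z, P w) ->
  \forall w \near poly_nbhs d z, \forall w' \near poly_nbhs d w, P w'.
Proof.
move=> [e /= e_gt0 eP]; exists (e / 2); first by rewrite /= divr_gt0.
move=> w [_ _ zw]; exists (e / 2); first by rewrite /= divr_gt0.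
move=> w' [sz1 sz2 ww']; apply: eP; split=> // i.
have [zw1 zw2] := zw i; have [ww1 ww2] := ww' i; split.
- by rewrite [e]splitr (le_lt_trans (ler_distD w.1`_i _ _)) ?ltrD.
- by rewrite [e]splitr (le_lt_trans (ler_distD w.2`_i _ _)) ?ltrD.
Qed.

Context {T : Type} {F : set_system T} {FF : Filter F}.
Implicit Types (f h : T -> {poly R}) (a : T -> R).

Lemma cvg_bigsum n (u : 'I_n -> T -> R) (l : 'I_n -> R) :
    (forall i, u i t @[t --> F] --> l i) ->
  \sum_(i < n) u i t @[t --> F] --> \sum_(i < n) l i.
Proof.
elim: n u l => [|n IH] u l ul.
  under eq_fun do rewrite big_ord0.
  by rewrite big_ord0; apply: cvg_cst.
under eq_fun do rewrite big_ord_recr /=.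
by rewrite big_ord_recr /=; apply: cvgD; [apply: IH|].
Qed.

Lemma cvg_expn a (l : R) n : a t @[t --> F] --> l -> a t ^+ n @[t --> F] --> l ^+ n.
Proof.
move=> al; elim: n => [|n IH].
  by under eq_fun do rewrite expr0; rewrite expr0; apply: cvg_cst.
by under eq_fun do rewrite exprS; rewrite exprS; apply: cvgM.
Qed.

Definition pcvg d f p :=
  [/\ \forall t \near F, (size (f t) <= d)%N, (size p <= d)%N &
      forall i, (f t)`_i @[t --> F] --> p`_i].

Lemma pcvg_poly_nbhs d f h p q :
  pcvg d f p -> pcvg d h q -> (f t, h t) @[t --> F] --> poly_nbhs d (p, q).
Proof.
move=> [szf szp fp] [szh szq hq] P [e /= e_gt0 eP].
rewrite /nbhs /=.
have near1 : \forall t \near F, forall i : 'I_d, `|p`_i - (f t)`_i| < e.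
  by apply: filter_forall => i; exact: cvgr_dist_lt (fp i) _ e_gt0.
have near2 : \forall t \near F, forall i : 'I_d, `|q`_i - (h t)`_i| < e.
  by apply: filter_forall => i; exact: cvgr_dist_lt (hq i) _ e_gt0.
near=> t; apply: eP.
have szft : (size (f t) <= d)%N by near: t.
have szht : (size (h t) <= d)%N by near: t.
split=> //= i; have [lt_id|le_di] := ltnP i d.
  split.
    have /(_ (Ordinal lt_id)) : forall i : 'I_d, `|p`_i - (f t)`_i| < e by near: t.
    by [].
  have /(_ (Ordinal lt_id)) : forall i : 'I_d, `|q`_i - (h t)`_i| < e by near: t.
  by [].
by rewrite !nth_default ?subrr ?normr0 ?(leq_trans _ le_di).
Unshelve. all: by end_near. Qed.

Lemma pcvg_cst d p : (size p <= d)%N -> pcvg d (fun=> p) p.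
Proof. by move=> szp; split=> //; [exact: nearW | move=> i; exact: cvg_cst]. Qed.

Lemma pcvgD d f h p q :
  pcvg d f p -> pcvg d h q -> pcvg d (fun t => f t + h t) (p + q).
Proof.
move=> [szf szp fp] [szh szq hq]; split.
- near=> t; rewrite (leq_trans (size_polyD _ _)) // geq_max.
  by apply/andP; split; near: t.
- by rewrite (leq_trans (size_polyD _ _)) // geq_max szp.
- move=> i; rewrite coefD; under eq_fun do rewrite coefD.
  by apply: cvgD.
Unshelve. all: by end_near. Qed.

Lemma pcvgZ d a f (l : R) p :
  a t @[t --> F] --> l -> pcvg d f p -> pcvg d (fun t => a t *: f t) (l *: p).
Proof.
move=> al [szf szp fp]; split.
- by near do apply: leq_trans (size_scale_leq _ _) _.
- exact: leq_trans (size_scale_leq _ _) _.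
- move=> i; rewrite coefZ; under eq_fun do rewrite coefZ.
  by apply: cvgM.
Unshelve. all: by end_near. Qed.

Lemma pcvgN d f p : pcvg d f p -> pcvg d (fun t => - f t) (- p).
Proof.
move=> [szf szp fp]; split; rewrite ?size_polyN //.
  by near do rewrite size_polyN.
move=> i; rewrite coefN; under eq_fun do rewrite coefN.
by apply: cvgN.
Unshelve. all: by end_near. Qed.

Lemma pcvgX d f p : pcvg d f p -> pcvg d.+1 (fun t => 'X * f t) ('X * p).
Proof.
have szX (r : {poly R}) : (size r <= d)%N -> (size ('X * r)%R <= d.+1)%N.
  by move=> szr; rewrite (leq_trans (size_polyMleq _ _)) // size_polyX.
move=> [szf szp fp]; split; [by near do apply: szX|exact: szX|].
move=> i; rewrite coefXM; under eq_fun do rewrite coefXM.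
by case: i => [|i] /=; [exact: cvg_cst|exact: fp].
Unshelve. all: by end_near. Qed.

Lemma cvg_horner d f p a (l : R) :
  pcvg d f p -> a t @[t --> F] --> l -> (f t).[a t] @[t --> F] --> p.[l].
Proof.
move=> [szf szp fp] al.
rewrite (horner_coef_wide _ szp).
apply: (@cvg_trans _ (\sum_(i < d) (f t)`_i * a t ^+ i @[t --> F])); last first.
  by apply: cvg_bigsum => i; apply: cvgM => //; exact: cvg_expn.
apply: near_eq_cvg; near=> t.
by rewrite (@horner_coef_wide _ d) //; near: t.
Unshelve. all: by end_near. Qed.

(** The quotient by 'X - a in closed form (synthetic division): its coefficients are visibly
    continuous in both a and p. *)
Definition synth d (a : R) p : {poly R} :=
  \poly_(j < d) \sum_(i < d) p`_(j.+1 + i) * a ^+ i.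

Lemma size_synth d (a : R) p : (size (synth d a p) <= d)%N.
Proof. exact: size_poly. Qed.

Lemma synthE d (a : R) p : (size p <= d.+1)%N ->
  p = ('X - a%:P) * synth d a p + (p.[a])%:P.
Proof.
move=> szp.
have cE j : (synth d a p)`_j = \sum_(i < d) p`_(j.+1 + i) * a ^+ i.
  rewrite coef_poly; case: ltnP => // le_dj; rewrite big1 // => i _.
  by rewrite nth_default ?mul0r // (leq_trans szp) // addSn ltnS (leq_trans le_dj) ?leq_addr.
have stepE j : p`_j + a * \sum_(i < d) p`_(j.+1 + i) * a ^+ i =
               \sum_(i < d) p`_(j + i) * a ^+ i + p`_(j + d) * a ^+ d.
  rewrite mulr_sumr -(big_ord_recr d (fun i => p`_(j + i) * a ^+ i)) /=.
  rewrite big_ord_recl /= addn0 expr0 mulr1; congr (_ + _).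
  by apply: eq_bigr => i _; rewrite mulrCA -exprS addSnnS.
apply/polyP => -[|j]; rewrite coefD mulrBl coefB coefXM coefCM coefC /=.
  rewrite cE sub0r (horner_coef_wide _ szp) big_ord_recr /=.
  have <- : p`_0 + a * \sum_(i < d) p`_(1 + i) * a ^+ i =
      \sum_(i < d) p`_i * a ^+ i + p`_d * a ^+ d := stepE 0%N.
  by rewrite addrC addrK.
rewrite addr0 !cE.
have := stepE j.+1; rewrite [p`_(_ + d)]nth_default; last first.
  by rewrite (leq_trans szp) // addSn ltnS leq_addl.
by rewrite mul0r addr0 => <-; rewrite addrK.
Qed.

Lemma synth_root d (a : R) p : (size p <= d.+1)%N -> p.[a] = 0 ->
  p = ('X - a%:P) * synth d a p.
Proof. by move=> szp pa0; rewrite {1}(synthE a szp) pa0 polyC0 addr0. Qed.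

Lemma synthK d (a : R) p : (size p <= d)%N -> synth d a (('X - a%:P) * p) = p.
Proof.
move=> szp; apply: (@mulfI _ ('X - a%:P)); first by rewrite polyXsubC_eq0.
rewrite -[LHS]addr0 -polyC0.
have -> : 0 = (('X - a%:P) * p).[a] :> R by rewrite hornerM hornerXsubC subrr mul0r.
rewrite -synthE //; rewrite (leq_trans (size_polyMleq _ _)) //.
by rewrite size_XsubC.
Qed.

Lemma pcvg_synth d a (l : R) f p :
  a t @[t --> F] --> l -> pcvg d.+1 f p ->
  pcvg d (fun t => synth d (a t) (f t)) (synth d l p).
Proof.
move=> al [szf szp fp]; split; rewrite ?size_synth //.
  by apply: nearW => t; rewrite size_synth.
move=> j; rewrite coef_poly; under eq_fun do rewrite coef_poly.
case: ltnP => _; last exact: cvg_cst.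
by apply: cvg_bigsum => i; apply: cvgM => //; exact: cvg_expn.
Qed.

End PolynomialLimits.

Arguments pcvg {R T} F d f p.

Lemma pcvg_fst (R : realType) d (z : {poly R} * {poly R}) :
  (size z.1 <= d)%N -> pcvg (poly_nbhs d z) d fst z.1.
Proof.
move=> szz; split=> //; first by exists 1 => //= w [].
move=> i; apply/cvgrPdist_lt => e e_gt0; exists e => // w [_ _ zw].
by have [] := zw i.
Qed.

Lemma pcvg_snd (R : realType) d (z : {poly R} * {poly R}) :
  (size z.2 <= d)%N -> pcvg (poly_nbhs d z) d snd z.2.
Proof.
move=> szz; split=> //; first by exists 1 => //= w [].
move=> i; apply/cvgrPdist_lt => e e_gt0; exists e => // w [_ _ zw].
by have [] := zw i.
Qed.

Lemma pcvg_comp (R : realType) (S T : Type) (F : set_system S) (G : set_system T)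
    d (f : S -> {poly R}) p (g : T -> S) :
  pcvg F d f p -> g @ G --> F -> pcvg G d (f \o g) p.
Proof.
move=> [szf szp fp] gF; split=> //; first exact: gF szf.
by move=> i; apply: cvg_comp (fp i).
Qed.

(** * Stably realizable pairs *)

(** After multiplication by [D.[mu]], the limit goes from negative to positive across mu; so do the
    nearby polynomials, and the intermediate value theorem yields a root near mu. *)
Lemma near_simple_root (R : realType) (T : Type) (F : set_system T)
    {FF : Filter F} d (f : T -> {poly R}) (D : {poly R}) (mu : R) (A : set R) :
    pcvg F d f (('X - mu%:P) * D) -> D.[mu] != 0 -> nbhs mu A ->
  \forall t \near F, exists2 x, A x & (f t).[x] = 0.
Proof.
move=> fD Dmu nA.
have nD : \forall x \near mu, 0 < D.[x] * D.[mu].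
  have DD : D.[x] * D.[mu] @[x --> mu] --> D.[mu] * D.[mu].
    apply: cvgM; last exact: cvg_cst.
    exact: cvg_horner (pcvg_cst (leqnn _)) cvg_id.
  by apply: cvgr_gt DD _ _; rewrite -expr2 exprn_even_gt0.
have /nbhs_ballP[e /= e_gt0 eB] : nbhs mu (A `&` [set x | 0 < D.[x] * D.[mu]]).
  exact: filterI.
have inB x : `|x - mu| <= e / 2 -> A x /\ 0 < D.[x] * D.[mu].
  move=> x_mu; apply: eB; rewrite /ball /= distrC (le_lt_trans x_mu) //.
  by rewrite ltr_pdivrMr // mulr2n mulrDr mulr1 ltrDl.
have e2_gt0 : 0 < e / 2 by rewrite divr_gt0.
have horner_f y : (f t).[y] * D.[mu] @[t --> F] --> (y - mu) * (D.[y] * D.[mu]).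
  have -> : (y - mu) * (D.[y] * D.[mu]) = (('X - mu%:P) * D).[y] * D.[mu].
    by rewrite hornerM hornerXsubC mulrA.
  by apply: cvgM; [exact: (cvg_horner fD (cvg_cst y))|exact: cvg_cst].
have [|_ posr] := inB (mu + e / 2); first by rewrite addrAC subrr add0r gtr0_norm.
have [|_ posl] := inB (mu - e / 2).
  by rewrite addrAC subrr add0r normrN gtr0_norm.
have rgt0 : \forall t \near F, 0 < (f t).[mu + e / 2] * D.[mu].
  apply: cvgr_gt (horner_f _) _ _.
  by rewrite addrAC subrr add0r mulr_gt0.
have llt0 : \forall t \near F, (f t).[mu - e / 2] * D.[mu] < 0.
  apply: cvgr_lt (horner_f _) _ _.
  by rewrite addrAC subrr add0r mulNr oppr_lt0 mulr_gt0.
near=> t.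
have [x /andP[x1 x2] /rootP xr] : exists2 x, mu - e / 2 <= x <= mu + e / 2 &
    root (D.[mu] *: f t) x.
  apply: poly_ivt; first lra.
  rewrite !hornerZ ![D.[mu] * _]mulrC; apply/andP; split; apply: ltW; near: t.
    exact: llt0.
  exact: rgt0.
exists x; first by have [] := inB x; rewrite // ler_norml; lra.
by move/eqP: xr; rewrite hornerZ mulf_eq0 (negPf Dmu) => /eqP.
Unshelve. all: by end_near. Qed.

Section States.
Context {R : realType}.
Implicit Types (E N Q : {poly R}) (ms : seq R) (m k b nu x sigma : R)
  (z w : {poly R} * {poly R}).

Definition admissible (L : seq (R * R * R)) : bool :=
  all (fun u => [&& 0 < mass u, 0 < u.1.2 & 0 <= u.2]) L.

(* A chain is described, up to a scalar, by the pair [(N, Q)] left when the   *)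
(* common factor [E] is removed from its transfer pair; [- 'X * N / Q] is the *)
(* dynamic stiffness of its first link in series with the rest.               *)
Definition realizable E ms (n : nat) z : Prop :=
  exists L c r, [/\ admissible L, size L = n, perm_eq (map mass L) (ms ++ r),
    c != 0 & transfer L = (c *: (z.2 * E), - c *: ('X * (z.1 * E)))].

Definition loaded_realizable E ms (n : nat) z : Prop :=
  exists L m r, [/\ admissible L, 0 < m, size L = n,
    perm_eq (m :: map mass L) (ms ++ r) &
    exists2 c, c != 0 &
      transfer L = (c *: (z.2 * E), - c *: ('X * ((z.1 - m *: z.2) * E)))].

Definition stable (P con : {poly R} * {poly R} -> Prop) (d : nat) z : Prop :=
  [/\ (size z.1 <= d)%N, (size z.2 <= d)%N, con z &
      \forall w \near poly_nbhs d z, con w -> P w].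

(* The ratio of [N] and [Q] is the effective mass seen from the wall; at      *)
(* [x = 0] it is the total mass.                                              *)
Definition mass_at (x sigma : R) z : Prop := z.1.[x] = sigma * z.2.[x].

Definition unconstrained z : Prop := True.

Lemma realizable_link E ms n N Q k b : 0 < k -> 0 <= b ->
  let s := k%:P - b *: 'X in
  loaded_realizable E ms n (N, Q) ->
  realizable E ms n.+1 (s * N, s * Q - 'X * N).
Proof.
move=> k_gt0 b_ge0 s [L [m [r [admL m_gt0 szL pL [c c_neq0 tL]]]]].
exists ((m, k, b) :: L), c, r; split=> //=; first by rewrite m_gt0 k_gt0 b_ge0.
  by rewrite szL.
rewrite tL /= /link /= /mass /= -/s -!mul_polyC; congr pair; ring.
Qed.

Lemma realizableM E ms n N Q h a : a != 0 ->
  realizable E ms n (a *: (h * N), a *: (h * Q)) -> realizable (E * h) ms n (N, Q).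
Proof.
move=> a_neq0 [L [c [r [admL szL pL c_neq0 tL]]]].
exists L, (c * a), r; split; rewrite ?mulf_neq0 //.
by rewrite tL /= -!mul_polyC; congr pair; ring.
Qed.

Lemma size_addZ d N Q m : (size N <= d)%N -> (size Q <= d)%N ->
  (size (N + m *: Q)%R <= d)%N.
Proof.
move=> szN szQ; rewrite (leq_trans (size_polyD _ _)) // geq_max szN.
by rewrite (leq_trans (size_scale_leq _ _)).
Qed.

Lemma pcvgBZ (T : Type) (F : set_system T) {FF : Filter F} d f h a N Q m :
    pcvg F d f (N + m *: Q) -> pcvg F d h Q -> a t @[t --> F] --> m ->
  (f t - a t *: h t, h t) @[t --> F] --> poly_nbhs d (N, Q).
Proof.
move=> fN hQ am; apply: pcvg_poly_nbhs => //.
rewrite -[N](addrK (m *: Q)); apply: pcvgD => //; apply: pcvgN; exact: pcvgZ.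
Qed.

(** The new mass is a spare parameter: for a nearby pair w, it is adjusted so that w.1 - m' w.2
    satisfies the old constraint at x. *)
Lemma stable_free_mass d E ms n x sigma N Q m :
    Q.[x] != 0 -> 0 < m ->
    stable (realizable E ms n) (mass_at x sigma) d (N, Q) ->
  stable (loaded_realizable E ms n) unconstrained d (N + m *: Q, Q).
Proof.
move=> Qx m_gt0 [/= szN szQ conNQ stNQ]; split=> //=; first exact: size_addZ.
set z := (N + m *: Q, Q).
have fstz : pcvg (poly_nbhs d z) d fst (N + m *: Q).
  by apply: (pcvg_fst (z := z)); exact: size_addZ.
have sndz : pcvg (poly_nbhs d z) d snd Q by exact: (pcvg_snd (z := z)).
have Qxz : w.2.[x] @[w --> poly_nbhs d z] --> Q.[x].
  exact: cvg_horner sndz (cvg_cst x).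
pose m' w := w.1.[x] / w.2.[x] - sigma.
have m'm : m' w @[w --> poly_nbhs d z] --> m.
  have -> : m = (N + m *: Q).[x] / Q.[x] - sigma.
    by rewrite hornerD hornerZ conNQ -mulrDl mulfK // addrAC subrr add0r.
  apply: cvgB; last exact: cvg_cst.
  apply: cvgM; last exact: cvgV.
  exact: cvg_horner fstz (cvg_cst x).
have near1 := pcvgBZ (FF := poly_nbhs_filter d z) fstz sndz m'm stNQ.
near=> w => _.
have m'_gt0 : 0 < m' w by near: w; exact: cvgr_gt m'm _ m_gt0.
have wx_neq0 : w.2.[x] != 0 by near: w; exact: cvgr_neq0 Qxz Qx.
have : mass_at x sigma (w.1 - m' w *: w.2, w.2) -> realizable E ms n (w.1 - m' w *: w.2, w.2).
  by near: w.
case.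
  by rewrite /mass_at /= hornerD hornerN hornerZ /m' mulrBl divfK // opprB addrCA subrr addr0.
move=> L [c [r [admL szL pL c_neq0 tL]]].
exists L, (m' w), (m' w :: r); split=> //; last by exists c.
by rewrite perm_sym -(cat1s _ r) perm_catCA /= perm_cons perm_sym.
Unshelve. all: by end_near. Qed.

(** A prescribed mass offers no freedom, so the constraint is carried over to the loaded pair. *)
Lemma stable_fixed_mass d E ms n (con con' : {poly R} * {poly R} -> Prop) N Q m :
    0 < m -> (forall w, con' w -> con (w.1 - m *: w.2, w.2)) ->
    con' (N + m *: Q, Q) ->
    stable (realizable E ms n) con d (N, Q) ->
  stable (loaded_realizable E (m :: ms) n) con' d (N + m *: Q, Q).
Proof.
move=> m_gt0 con'P con'NQ [/= szN szQ _ stNQ]; split=> //=; first exact: size_addZ.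
set z := (N + m *: Q, Q).
have fstz : pcvg (poly_nbhs d z) d fst (N + m *: Q).
  by apply: (pcvg_fst (z := z)); exact: size_addZ.
have sndz : pcvg (poly_nbhs d z) d snd Q by exact: (pcvg_snd (z := z)).
have near1 := pcvgBZ (FF := poly_nbhs_filter d z) fstz sndz (cvg_cst m) stNQ.
near=> w => /con'P conw.
have : con (w.1 - m *: w.2, w.2) -> realizable E ms n (w.1 - m *: w.2, w.2).
  by near: w; exact: near1.
move=> /(_ conw)[L [c [r [admL szL pL c_neq0 tL]]]].
exists L, m, r; split=> //; last by exists c.
by rewrite /= perm_cons.
Unshelve. all: by end_near. Qed.

(* The link added here is chosen very stiff: in the limit it does not move    *)
(* [(N, Q)], and it only contributes the factor [nu - 'X].                    *)
Lemma stable_blocking_link d E ms n N Q nu : 0 < nu -> N.[nu] = 0 ->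
    stable (loaded_realizable E ms n) unconstrained d.+1 (N, Q) ->
  stable (realizable (E * (nu%:P - 'X)) ms n.+1) (mass_at nu 0) d.+1 (N, Q).
Proof.
move=> nu_gt0 Nnu [/= szN szQ _ stNQ]; split=> //=; first by rewrite /mass_at /= Nnu mul0r.
set z := (N, Q); set G := filter_prod (0 : R)^'+ (poly_nbhs d.+1 z).
have fstG : pcvg G d.+1 (fun t => t.2.1) N.
  by apply: (pcvg_comp (pcvg_fst (z := z) szN)); exact: cvg_snd.
have sndG : pcvg G d.+1 (fun t => t.2.2) Q.
  by apply: (pcvg_comp (pcvg_snd (z := z) szQ)); exact: cvg_snd.
have eG : t.1 @[t --> G] --> (0 : R).
  apply: cvg_trans (cvg_fst (F := (0 : R)^'+)) _; exact: cvg_within.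
(* Undoing the link (nu - 'X) / e only changes w.2 by e 'X times the quotient of w.1 by 'X - nu,
   which is negligible for small e. *)
have cvgG : (t.2.1, t.2.2 - t.1 *: ('X * synth d nu t.2.1)) @[t --> G] --> poly_nbhs d.+1 z.
  apply: pcvg_poly_nbhs => //.
  have -> : Q = Q - 0 *: ('X * synth d nu N) by rewrite scale0r subr0.
  apply: pcvgD => //; apply: pcvgN; apply: pcvgZ => //; apply: pcvgX.
  by apply: pcvg_synth => //; exact: cvg_cst.
have [[A B] /= [nA nB] AB] := cvgG _ stNQ.
have /filter_ex[e [e_gt0 Ae]] : (0 : R)^'+ ([set e | 0 < e] `&` A).
  by apply: filterI => //; exact: nbhs_right_gt.
have szG : poly_nbhs d.+1 z (fun w => (size w.1 <= d.+1)%N).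
  by have [] := pcvg_fst (z := z) szN.
near=> w; rewrite /mass_at mul0r => w1nu.
have szw : (size w.1 <= d.+1)%N by near: w.
have Bw : B w by near: w.
have /(realizable_link (k := e^-1 * nu) (b := e^-1)) :=
  AB (e, w) (conj Ae Bw) I.
rewrite /= mulr_gt0 ?invr_gt0 // invr_ge0 ltW // => /(_ isT isT) real_w.
rewrite [w]surjective_pairing; apply: (@realizableM _ _ _ _ _ _ e^-1).
  by rewrite invr_eq0 gt_eqF.
have eK : e^-1%:P * e%:P = 1 :> {poly R} by rewrite -polyCM mulVf ?gt_eqF.
rewrite {1}[w.1](synth_root szw w1nu).
have -> : e^-1 *: ((nu%:P - 'X) * w.2) =
    ((e^-1 * nu)%:P - e^-1 *: 'X) * (w.2 - e *: ('X * synth d nu w.1)) - 'X * w.1.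
  rewrite {2}[w.1](synth_root szw w1nu) -!mul_polyC polyCM.
  set D := synth d nu w.1; set u := e^-1%:P; set v := e%:P.
  transitivity (u * ((nu%:P - 'X) * w.2) + (1 - u * v) * 'X * ((nu%:P - 'X) * D)); last by ring.
  by rewrite /u /v eK subrr !mul0r addr0.
have -> : e^-1 *: ((nu%:P - 'X) * (('X - nu%:P) * synth d nu w.1)) =
    ((e^-1 * nu)%:P - e^-1 *: 'X) * w.1.
  rewrite {2}[w.1](synth_root szw w1nu) -!mul_polyC polyCM; ring.
exact: real_w.
Unshelve. all: by end_near. Qed.

End States.

(** * Undoing a link, and perturbing a pair to reach an eigenvalue exactly *)

Section Steps.
Context {R : realType}.
Implicit Types (E N P Q : {poly R}) (ms : seq R) (m k b nu x sigma rho g la : R)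
  (z w : {poly R} * {poly R}).

(** A nearby w is dismantled: w.1 keeps a root x near k / b, which is taken as the zero of the new
    link, and the inner pair found by division tends to (N, Q). *)
Lemma stable_link d E ms n (con : {poly R} * {poly R} -> Prop) N Q k b :
    let s := k%:P - b *: 'X in
    0 < k -> 0 < b -> N.[k / b] != 0 ->
    (forall w k' b', k' != 0 ->
       con ((k'%:P - b' *: 'X) * w.1, (k'%:P - b' *: 'X) * w.2 - 'X * w.1) ->
       con w) ->
    con (s * N, s * Q - 'X * N) ->
    stable (loaded_realizable E ms n) con d.+1 (N, Q) ->
  stable (realizable E ms n.+1) con d.+2 (s * N, s * Q - 'X * N).
Proof.
move=> s k_gt0 b_gt0 Nmu conP conA [/= szN szQ _ stNQ].
set mu := k / b in Nmu.
have mu_gt0 : 0 < mu by exact: divr_gt0.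
have b_neq0 : b != 0 by rewrite gt_eqF.
have sE : s = ('X - mu%:P) * (- b)%:P.
  have kE : k = mu * b by rewrite divfK.
  by rewrite /s kE -mul_polyC polyCM polyCN; ring.
have szs : (size s <= 2)%N.
  by rewrite sE mulrC mul_polyC (leq_trans (size_scale_leq _ _)) ?size_XsubC.
have szsM (p : {poly R}) : (size p <= d.+1)%N -> (size (s * p)%R <= d.+2)%N.
  by move=> szp; apply: leq_trans (size_polyMleq _ _) _; lia.
have szXM (p : {poly R}) : (size p <= d.+1)%N -> (size ('X * p)%R <= d.+2)%N.
  by move=> szp; rewrite (leq_trans (size_polyMleq _ _)) // size_polyX.
have szA : (size (s * Q - 'X * N)%R <= d.+2)%N.
  by rewrite (leq_trans (size_polyD _ _)) // geq_max size_polyN szsM ?szXM.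
split=> //=; first exact: szsM.
set z := (s * N, s * Q - 'X * N).
pose G := filter_prod (nbhs mu) (poly_nbhs d.+2 z).
have fstG : pcvg G d.+2 (fun t => t.2.1) (s * N).
  by apply: (pcvg_comp (pcvg_fst (z := z) (szsM _ szN))); exact: cvg_snd.
have sndG : pcvg G d.+2 (fun t => t.2.2) (s * Q - 'X * N).
  by apply: (pcvg_comp (pcvg_snd (z := z) szA)); exact: cvg_snd.
have xG : t.1 @[t --> G] --> mu by exact: cvg_fst.
pose D (t : R * ({poly R} * {poly R})) := synth d.+1 t.1 t.2.1.
(* The inertance is forced: it is the value for which w.2 + 'X * NB vanishes at x, hence is
   divisible by the link. *)
pose kappa (t : R * ({poly R} * {poly R})) := t.1 * (D t).[t.1] / t.2.2.[t.1].
pose NB t := - (kappa t)^-1 *: D t.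
pose QB t := - (kappa t)^-1 *: synth d.+1 t.1 (t.2.2 + 'X * NB t).
have synth_s (p : {poly R}) : (size p <= d.+1)%N -> synth d.+1 mu (s * p) = - b *: p.
  move=> szp; rewrite sE -mulrA synthK ?mul_polyC //.
  exact: leq_trans (size_scale_leq _ _) _.
have s_mu : s.[mu] = 0 by rewrite sE hornerM hornerXsubC subrr mul0r.
have z2mu : (s * Q - 'X * N).[mu] = - (mu * N.[mu]).
  by rewrite hornerD hornerN !hornerM s_mu mul0r sub0r hornerX.
have z2mu_neq0 : (s * Q - 'X * N).[mu] != 0.
  by rewrite z2mu oppr_eq0 mulf_eq0 negb_or Nmu gt_eqF.
have DG : pcvg G d.+1 D (- b *: N).
  by rewrite -synth_s //; exact: pcvg_synth.
have kappaG : kappa t @[t --> G] --> b.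
  have -> : b = mu * (- b *: N).[mu] / (s * Q - 'X * N).[mu].
    rewrite z2mu hornerZ; field.
    by rewrite Nmu gt_eqF.
  apply: cvgM; first by apply: cvgM => //; exact: cvg_horner DG xG.
  apply: cvgV z2mu_neq0 _.
  exact: cvg_horner sndG xG.
have NkappaVG : - (kappa t)^-1 @[t --> G] --> - b^-1.
  by apply: cvgN; apply: cvgV.
have cancelb (p : {poly R}) : - b^-1 *: (- b *: p) = p.
  by rewrite scalerA mulrNN mulVf // scale1r.
have NBG : pcvg G d.+1 NB N.
  by rewrite -[N]cancelb; exact: pcvgZ.
have QBG : pcvg G d.+1 QB Q.
  rewrite -[Q]cancelb; apply: pcvgZ => //; rewrite -synth_s //.
  rewrite -[s * Q](subrK ('X * N)); apply: pcvg_synth => //.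
  by apply: pcvgD => //; exact: pcvgX.
have [[A B] /= [nA nB] AB] : G (fun t => (con (NB t, QB t) ->
    loaded_realizable E ms n (NB t, QB t)) /\ [/\ 0 < t.1, t.2.2.[t.1] != 0 & 0 < kappa t]).
  near=> t; split.
    by near: t; exact: (pcvg_poly_nbhs NBG QBG) _ stNQ.
  split; near: t.
  - exact: cvgr_gt xG _ mu_gt0.
  - exact: cvgr_neq0 (cvg_horner sndG xG) z2mu_neq0.
  - exact: cvgr_gt kappaG _ b_gt0.
have rootA : \forall w \near poly_nbhs d.+2 z, exists2 x, A x & w.1.[x] = 0.
  apply: (near_simple_root (d := d.+2) (D := - b *: N)) nA.
  - have <- : s * N = ('X - mu%:P) * (- b *: N) by rewrite sE -mulrA mul_polyC.
    exact: (pcvg_fst (z := z) (szsM _ szN)).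
  - by rewrite hornerZ mulf_neq0 ?oppr_eq0.
have szG1 : poly_nbhs d.+2 z (fun w => (size w.1 <= d.+2)%N).
  by have [] := pcvg_fst (z := z) (szsM _ szN).
have szG2 : poly_nbhs d.+2 z (fun w => (size w.2 <= d.+2)%N).
  by have [] := pcvg_snd (z := z) szA.
near=> w => con_w.
have szw1 : (size w.1 <= d.+2)%N by near: w.
have szw2 : (size w.2 <= d.+2)%N by near: w.
have Bw : B w by near: w.
have [x Ax w1x] : exists2 x, A x & w.1.[x] = 0 by near: w.
have [real_x [/= x_gt0 w2x kap_gt0]] := AB (x, w) (conj Ax Bw).
have kap_neq0 : kappa (x, w) != 0 by rewrite gt_eqF.
set t := (x, w) in real_x kap_gt0 kap_neq0.
have w1E : w.1 = ((kappa t * x)%:P - kappa t *: 'X) * NB t.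
  have -> : w.1 = ('X - x%:P) * D t by exact: synth_root.
  rewrite /NB -!mul_polyC polyCM polyCN.
  have kK : (kappa t)%:P * (kappa t)^-1%:P = 1 :> {poly R} by rewrite -polyCM mulfV.
  transitivity ((kappa t)%:P * (kappa t)^-1%:P * (('X - x%:P) * D t)); last by ring.
  by rewrite kK mul1r.
have wNB_root : (w.2 + 'X * NB t).[x] = 0.
  rewrite hornerD hornerM hornerX /NB hornerZ /kappa /=.
  have Dx : (D t).[x] != 0.
    by apply: contraNneq kap_neq0 => Dx0; rewrite /kappa /= Dx0 mulr0 mul0r.
  rewrite invf_div; field.
  by rewrite Dx gt_eqF.
have szwNB : (size (w.2 + 'X * NB t)%R <= d.+2)%N.
  rewrite (leq_trans (size_polyD _ _)) // geq_max szw2 szXM //.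
  by rewrite (leq_trans (size_scale_leq _ _)) // size_synth.
have w2E : w.2 = ((kappa t * x)%:P - kappa t *: 'X) * QB t - 'X * NB t.
  apply/eqP; rewrite eq_sym subr_eq; apply/eqP.
  rewrite [RHS](synth_root szwNB wNB_root) /QB.
  rewrite -!mul_polyC polyCM polyCN.
  have kK : (kappa t)%:P * (kappa t)^-1%:P = 1 :> {poly R} by rewrite -polyCM mulfV.
  set S := synth _ _ _.
  transitivity ((kappa t)%:P * (kappa t)^-1%:P * (('X - x%:P) * S)); first by ring.
  by rewrite kK mul1r.
rewrite [w]surjective_pairing w1E {1}w2E.
have kx_gt0 : 0 < kappa t * x by exact: mulr_gt0.
apply: realizable_link => //; first exact: ltW.
apply: real_x; apply: (conP (NB t, QB t) (kappa t * x) (kappa t)).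
  by rewrite mulf_neq0 // gt_eqF.
by rewrite /= -w2E -w1E -surjective_pairing.
Unshelve. all: by end_near. Qed.

(* Adding an eigenvalue [la]: [rho] close to [la] is the frequency at which a *)
(* wall link [rho / g - b *: 'X] and a mass [m] with [b + m = 1 / g] cancel.  *)
Definition root_cond N P la rho g : Prop :=
  P.[rho] * (la - rho) + g * la * N.[rho] = 0.

(** The solution Q of (rho - 'X) Q = P (la - 'X) + (g la / rho) 'X N, the right-hand side vanishing
    at rho by [root_cond]. *)
Definition perturbed d N P la rho g : {poly R} :=
  - synth d rho (P * (la%:P - 'X) + (g * la / rho) *: ('X * N)).

(** Along rho = la + e0 * e the condition determines g, which tends to 0 with e; taking e0 to be the
    sign of P / N at la makes g positive. If N vanishes at la, then rho = la works for every g. *)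
Lemma exists_root_cond N P la (A : set (R * R)) : 0 < la -> P.[la] != 0 ->
    filter_prod (nbhs la) (0 : R)^'+ A ->
  exists rho g, A (rho, g) /\ root_cond N P la rho g.
Proof.
move=> la_gt0 Pla [[U V] /= [nU nV] UV].
have [Nla|Nla] := eqVneq N.[la] 0.
  have [g Vg] := filter_ex nV.
  exists la, g; split; first by apply: UV; split=> //=; exact: nbhs_singleton.
  by rewrite /root_cond Nla subrr !mulr0 addr0.
pose c := P.[la] / N.[la]; pose e0 := Num.sg c.
have c_neq0 : c != 0 by rewrite mulf_neq0 ?invr_eq0.
pose rho e := la + e0 * e.
have rho_la : rho e @[e --> (0 : R)^'+] --> la.
  have -> : la = la + e0 * 0 by rewrite mulr0 addr0.
  apply: cvgD; first exact: cvg_cst.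
  by apply: cvgM; [exact: cvg_cst|exact: cvg_within].
pose ratio e := e0 * (P.[rho e] / N.[rho e]) / la.
have ratio_c : ratio e @[e --> (0 : R)^'+] --> `|c| / la.
  rewrite normrEsg -/e0; apply: cvgM; last exact: cvg_cst.
  apply: cvgM; first exact: cvg_cst.
  apply: cvgM; first exact: cvg_horner (pcvg_cst (leqnn _)) rho_la.
  by apply: cvgV => //; exact: cvg_horner (pcvg_cst (leqnn _)) rho_la.
pose g e := e * ratio e.
have g_0 : g e @[e --> (0 : R)^'+] --> 0 * (`|c| / la).
  by apply: cvgM => //; exact: cvg_within.
rewrite mul0r in g_0.
have /filter_ex[e [[[e_gt0 Ue] [r_gt0 Ve]] Ne]] : (0 : R)^'+ [set e | ((0 < e /\ U (rho e)) /\
    (0 < ratio e /\ (0 < g e -> V (g e)))) /\ N.[rho e] != 0].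
  near=> e; split; [split; split|]; near: e.
  - exact: nbhs_right_gt.
  - exact: (rho_la _ nU).
  - by apply: cvgr_gt ratio_c _ _; rewrite divr_gt0 ?normr_gt0.
  - exact: (g_0 _ nV).
  - by apply: cvgr_neq0 Nla; exact: cvg_horner (pcvg_cst (leqnn _)) rho_la.
exists (rho e), (g e); split.
  by apply: UV; split=> //=; apply: Ve; rewrite mulr_gt0.
rewrite /root_cond /g /ratio.
have -> : la - rho e = - (e0 * e) by rewrite /rho opprD addrA subrr add0r.
by field; rewrite Ne gt_eqF.
Unshelve. all: by end_near. Qed.

Lemma perturbedE d N P la rho g : (size N <= d)%N -> (size P <= d)%N ->
    rho != 0 -> root_cond N P la rho g ->
  (rho%:P - 'X) * perturbed d N P la rho g =
  P * (la%:P - 'X) + (g * la / rho) *: ('X * N).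
Proof.
move=> szN szP rho_neq0 root_rho.
rewrite /perturbed mulrN -mulNr opprB; symmetry; apply: synth_root.
  rewrite (leq_trans (size_polyD _ _)) // geq_max; apply/andP; split.
    rewrite (leq_trans (size_polyMleq _ _)) // -opprB size_polyN.
    by rewrite size_XsubC addn2.
  rewrite (leq_trans (size_scale_leq _ _)) //.
  by rewrite (leq_trans (size_polyMleq _ _)) // size_polyX.
rewrite hornerD hornerZ !hornerM hornerD hornerN hornerC !hornerX.
by rewrite -[RHS]root_rho; field.
Qed.

Lemma pcvg_perturbed d N P la : (size N <= d)%N -> (size P <= d)%N -> 0 < la ->
  pcvg (filter_prod (nbhs la) (0 : R)^'+) d
    (fun t => perturbed d N P la t.1 t.2) P.
Proof.
move=> szN szP la_gt0; rewrite /perturbed.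
have t1 : t.1 @[t --> filter_prod (nbhs la) (0 : R)^'+] --> la by exact: cvg_fst.
have t2 : t.2 @[t --> filter_prod (nbhs la) (0 : R)^'+] --> (0 : R).
  apply: cvg_trans (cvg_snd (G := (0 : R)^'+)) _; exact: cvg_within.
have PE : P * (la%:P - 'X) = ('X - la%:P) * - P by ring.
have {2}-> : P = - synth d la (P * (la%:P - 'X) + (0 * la / la) *: ('X * N)).
  by rewrite !mul0r scale0r addr0 PE synthK ?opprK // size_polyN.
apply: pcvgN; apply: pcvg_synth => //; apply: pcvgD.
  apply: pcvg_cst; rewrite (leq_trans (size_polyMleq _ _)) // -opprB size_polyN.
  by rewrite size_XsubC addn2.
apply: pcvgZ.
  apply: cvgM; last by apply: cvgV => //; rewrite gt_eqF.
  by apply: cvgM => //; exact: cvg_cst.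
by apply: pcvg_cst; rewrite (leq_trans (size_polyMleq _ _)) // size_polyX.
Qed.

(** The perturbed pair tends to (N, P), so the chain built before absorbs the perturbation. The
    factor la / rho preserves the total mass: at 0, [perturbedE] reads rho Q(0) = la P(0). *)
Lemma stable_perturbed d (W : {poly R} * {poly R} -> Prop) x sigma N P la :
    0 < la -> x = 0 \/ sigma = 0 -> stable W (mass_at x sigma) d (N, P) ->
  \forall t \near filter_prod (nbhs la) (0 : R)^'+,
    root_cond N P la t.1 t.2 ->
    stable W (mass_at x sigma) d ((la / t.1) *: N, perturbed d N P la t.1 t.2).
Proof.
move=> la_gt0 x_sigma [/= szN szP conNP stNP].
have PG := pcvg_perturbed szN szP la_gt0.
have t1 : t.1 @[t --> filter_prod (nbhs la) (0 : R)^'+] --> la by exact: cvg_fst.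
have NG : pcvg (filter_prod (nbhs la) (0 : R)^'+) d (fun t => (la / t.1) *: N) N.
  have {2}-> : N = (la / la) *: N by rewrite divff ?scale1r ?gt_eqF.
  apply: pcvgZ; last exact: pcvg_cst.
  by apply: cvgM; [exact: cvg_cst|apply: cvgV; rewrite ?gt_eqF].
have near1 := pcvg_poly_nbhs NG PG (poly_nbhs_interior stNP).
near=> t => root_t.
have t_gt0 : 0 < t.1 by near: t; exact: cvgr_gt t1 _ la_gt0.
have t_neq0 : t.1 != 0 by rewrite gt_eqF.
split=> /=.
- by rewrite (leq_trans (size_scale_leq _ _)).
- by rewrite /perturbed size_polyN size_synth.
- rewrite /mass_at /=; case: x_sigma conNP => [->|->]; rewrite /mass_at /= => conNP.
    move: (perturbedE szN szP t_neq0 root_t); move: (perturbed _ _ _ _ _ _) => q.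
    move=> /(congr1 (fun p : {poly R} => p.[0])).
    rewrite /= hornerD hornerZ !hornerM !hornerD !hornerN !hornerC !hornerX.
    rewrite !subr0 mul0r mulr0 addr0 => tq; apply: (mulfI t_neq0).
    rewrite hornerZ conNP [RHS]mulrCA tq; field.
    exact: t_neq0.
  by rewrite hornerZ conNP !mul0r mulr0.
- by near: t; exact: near1.
Unshelve. all: by end_near. Qed.

End Steps.

(** * Adding an eigenvalue *)

Section Levels.
Context {R : realType}.
Implicit Types (E N P Q : {poly R}) (ms : seq R)
  (m k b nu x sigma rho g la v y : R) (z w : {poly R} * {poly R}).

Lemma near_all_seq (T : Type) (I : eqType) (F : set_system T) {FF : Filter F}
    (s : seq I) (A : I -> T -> Prop) :
    (forall i, i \in s -> \forall t \near F, A i t) ->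
  \forall t \near F, forall i, i \in s -> A i t.
Proof.
elim: s => [|i s IH] As; first exact: nearW.
have Ai := As i (mem_head _ _).
have {}IH := IH (fun j js => As j (mem_behead (s := i :: s) js)).
near=> t => j; rewrite inE => /predU1P[->|js]; first by near: t.
by move: j js; near: t.
Unshelve. all: by end_near. Qed.

(** As b + m = 1 / g, the coefficient of Q is (rho - 'X) / g, and the equation defining [perturbed]
    cancels the term in N. *)
Lemma perturbed_link d N P la rho g m b : (size N <= d)%N -> (size P <= d)%N ->
    rho != 0 -> g != 0 -> root_cond N P la rho g -> b + m = g^-1 ->
  let Q := perturbed d N P la rho g in
  ((rho / g)%:P - b *: 'X) * Q - 'X * ((la / rho) *: N + m *: Q) =
  g^-1 *: (P * (la%:P - 'X)).
Proof.
move=> szN szP rho_neq0 g_neq0 root_rho bm Q.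
have := perturbedE szN szP rho_neq0 root_rho; rewrite -/Q => QE.
have -> : b = g^-1 - m by rewrite -bm addrK.
have -> : g^-1 *: (P * (la%:P - 'X)) =
    g^-1 *: ((rho%:P - 'X) * Q - (g * la / rho) *: ('X * N)) by rewrite QE addrK.
have -> : la / rho = g^-1 * (g * la / rho).
  by field; rewrite rho_neq0 g_neq0.
by rewrite -!mul_polyC !polyCM polyCB; ring.
Qed.

(** Evaluate [perturbed_link] at the zero of the link, where only the term in 'X times the loaded
    numerator survives. This provides the nonvanishing required by [stable_link]. *)
Lemma perturbed_link_neq0 d N P la rho g m b :
    (size N <= d)%N -> (size P <= d)%N ->
    rho != 0 -> g != 0 -> root_cond N P la rho g -> b + m = g^-1 -> b != 0 ->
    P.[rho / g / b] != 0 -> rho / g / b != la ->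
  ((la / rho) *: N + m *: perturbed d N P la rho g).[rho / g / b] != 0.
Proof.
move=> szN szP rho_neq0 g_neq0 root_rho bm b_neq0 Pmu mu_la.
have bmu : b * (rho / g / b) = rho / g by rewrite mulrC divfK.
move: (rho / g / b) bmu Pmu mu_la => mu bmu Pmu mu_la.
have /(congr1 (fun p : {poly R} => p.[mu])) :=
  perturbed_link szN szP rho_neq0 g_neq0 root_rho bm.
set N1 := (la / rho) *: N + _; move: (perturbed _ _ _ _ _ _) => q.
rewrite /= hornerD hornerN hornerZ !hornerM !hornerD !hornerN hornerZ !hornerC !hornerX.
rewrite bmu subrr mul0r sub0r => H.
apply/eqP => N10; move/eqP: H; rewrite N10 mulr0 oppr0 eq_sym.
rewrite mulf_eq0 mulf_eq0 invr_eq0 (negPf g_neq0) (negPf Pmu) /=.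
by rewrite subr_eq0 eq_sym (negPf mu_la).
Qed.

Lemma cvg_perturbation_freq la :
  t.1 @[t --> filter_prod (nbhs la) (0 : R)^'+] --> la.
Proof. exact: cvg_fst. Qed.

Lemma cvg_perturbation_size la :
  t.2 @[t --> filter_prod (nbhs la) (0 : R)^'+] --> (0 : R).
Proof. by apply: cvg_trans (cvg_snd (G := (0 : R)^'+)) _; exact: cvg_within. Qed.

Lemma near_perturbation_size_gt0 la :
  \forall t \near filter_prod (nbhs la) (0 : R)^'+, 0 < t.2.
Proof. exact: (cvg_snd (F := nbhs la)) (nbhs_right_gt 0). Qed.

Lemma cvg_perturbed d N P la y : (size N <= d)%N -> (size P <= d)%N -> 0 < la ->
  (perturbed d N P la t.1 t.2).[y] @[t --> filter_prod (nbhs la) (0 : R)^'+]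
    --> P.[y].
Proof.
move=> szN szP la_gt0.
exact: cvg_horner (pcvg_perturbed szN szP la_gt0) (cvg_cst y).
Qed.

(** Meant for the last eigenvalue, where realizability is the goal; it accepts the constraint left
    either by simple levels (x = 0) or by blocking links (sigma = 0). *)
Lemma realizable_wall_mass d E ms n x sigma N P la m :
    0 < la -> 0 < m -> x = 0 \/ sigma = 0 -> P.[la] != 0 ->
    stable (realizable E ms n) (mass_at x sigma) d (N, P) ->
  exists N' a, a != 0 /\ realizable E (m :: ms) n.+1 (N', a *: (P * (la%:P - 'X))).
Proof.
move=> la_gt0 m_gt0 x_sigma Pla stNP; have [/= szN szP _ _] := stNP.
pose G := filter_prod (nbhs la) (0 : R)^'+.
have t1 := @cvg_perturbation_freq la; have t2 := @cvg_perturbation_size la.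
have near1 := stable_perturbed la_gt0 x_sigma stNP.
have /(exists_root_cond N la_gt0 Pla)[rho [g [[/= stQ [rho_gt0 g_gt0 gm]] root_rho]]] :
    G (fun t => (root_cond N P la t.1 t.2 -> stable (realizable E ms n)
      (mass_at x sigma) d ((la / t.1) *: N, perturbed d N P la t.1 t.2)) /\
      [/\ 0 < t.1, 0 < t.2 & t.2 < m^-1]).
  near=> t; split; first by near: t.
  split; near: t.
  - exact: cvgr_gt t1 _ la_gt0.
  - exact: near_perturbation_size_gt0.
  - by apply: cvgr_lt t2 _ _; rewrite invr_gt0.
have b_gt0 : 0 < g^-1 - m by rewrite subr_gt0 -[m]invrK ltf_pV2 ?posrE ?invr_gt0.
have {}stQ := stQ root_rho.
exists (((rho / g)%:P - (g^-1 - m) *: 'X) *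
  ((la / rho) *: N + m *: perturbed d N P la rho g)), g^-1.
split; first by rewrite invr_eq0 gt_eqF.
have /= <- := perturbed_link (m := m) (b := g^-1 - m) szN szP
  (lt0r_neq0 rho_gt0) (lt0r_neq0 g_gt0) root_rho (subrK _ _).
apply: realizable_link; [by rewrite divr_gt0|exact: ltW|].
pose con' (w : {poly R} * {poly R}) := mass_at x sigma (w.1 - m *: w.2, w.2).
have [/= szN' szQ' conQ _] := stQ.
have := stable_fixed_mass (con' := con') m_gt0 (fun w => id) _ stQ.
rewrite /con' /= addrK => /(_ conQ)[/= ? ? _ /poly_nbhs_self]; apply=> //=.
by rewrite addrK.
Unshelve. all: by end_near. Qed.

(** While all masses are prescribed, the constraint fixes the total mass. The sign condition at
    later eigenvalues propagates, since g^2 N' Q' at y tends to (la - y)^2 (N P + m P^2). At la it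
    gives N + m P != 0, which keeps the zero of the link away from la. *)
Lemma stable_wall_mass d E ms n sigma N P la m (ys : seq R) :
    0 < la -> 0 < m -> P.[la] != 0 -> 0 <= N.[la] * P.[la] ->
    (forall y, y \in ys -> [/\ y != la, P.[y] != 0 & 0 <= N.[y] * P.[y]]) ->
    stable (realizable E ms n) (mass_at 0 sigma) d.+1 (N, P) ->
  exists N' a, [/\ a != 0,
    forall y, y \in ys -> 0 <= N'.[y] * (a *: (P * (la%:P - 'X))).[y] &
    stable (realizable E (m :: ms) n.+1) (mass_at 0 (sigma + m)) d.+2
      (N', a *: (P * (la%:P - 'X)))].
Proof.
move=> la_gt0 m_gt0 Pla NPla ysP stNP; have [/= szN szP _ _] := stNP.
pose G := filter_prod (nbhs la) (0 : R)^'+.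
have t1 := @cvg_perturbation_freq la; have t2 := @cvg_perturbation_size la.
have near1 := stable_perturbed la_gt0 (or_introl (erefl 0)) stNP.
pose mu (t : R * R) := t.1 / (1 - t.2 * m).
have den1 : 1 - t.2 * m @[t --> G] --> 1 - 0 * m.
  by apply: cvgB; [exact: cvg_cst|apply: cvgM => //; exact: cvg_cst].
rewrite mul0r subr0 in den1.
have mu_la : mu t @[t --> G] --> la / 1.
  by apply: cvgM => //; apply: cvgV => //; exact: oner_neq0.
rewrite divr1 in mu_la.
pose value y (t : R * R) := ((t.1 - (1 - t.2 * m) * y) *
  (la / t.1 * N.[y] + m * (perturbed d.+1 N P la t.1 t.2).[y])) * (P.[y] * (la - y)).
have valueP y : value y t @[t --> G] --> ((la - 1 * y) *
    (la / la * N.[y] + m * P.[y])) * (P.[y] * (la - y)).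
  apply: cvgM; last exact: cvg_cst.
  apply: cvgM.
    by apply: cvgB => //; apply: cvgM => //; exact: cvg_cst.
  apply: cvgD; apply: cvgM; try exact: cvg_cst; last exact: cvg_perturbed.
  by apply: cvgM; [exact: cvg_cst|apply: cvgV => //; rewrite gt_eqF].
have near2 : \forall t \near G, forall y, y \in ys -> 0 < value y t.
  apply: near_all_seq => y /ysP[y_la Py NPy].
  apply: cvgr_gt (valueP y) _ _; rewrite divff ?gt_eqF // !mul1r.
  have -> : (la - y) * (N.[y] + m * P.[y]) * (P.[y] * (la - y)) =
    (la - y) ^+ 2 * (N.[y] * P.[y] + m * P.[y] ^+ 2) by ring.
  apply: mulr_gt0; first by rewrite exprn_even_gt0 //= subr_eq0 eq_sym.
  by rewrite ltr_wpDl // mulr_gt0 // exprn_even_gt0.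
have NmP : N.[la] + m * P.[la] != 0.
  apply: contraTneq NPla => /eqP; rewrite addr_eq0 => /eqP ->.
  by rewrite -ltNge mulNr oppr_lt0 -mulrA -expr2 mulr_gt0 // exprn_even_gt0.
have /(exists_root_cond N la_gt0 Pla)[rho [g [[/= [stQ val_gt0] [[rho_gt0 g_gt0 gm] [Pmu Nrho]]] root_rho]]] :
    G (fun t => ((root_cond N P la t.1 t.2 -> stable (realizable E ms n)
      (mass_at 0 sigma) d.+1 ((la / t.1) *: N, perturbed d.+1 N P la t.1 t.2)) /\
      (forall y, y \in ys -> 0 < value y t)) /\
      ([/\ 0 < t.1, 0 < t.2 & t.2 < m^-1] /\
       (P.[mu t] != 0 /\ N.[t.1] + m * P.[t.1] != 0))).
  have hornerG (p : {poly R}) (a : R * R -> R) : a t @[t --> G] --> la ->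
      p.[a t] @[t --> G] --> p.[la].
    exact: cvg_horner (pcvg_cst (leqnn _)).
  near=> t; split; first by split; near: t.
  split; split; near: t.
  - exact: cvgr_gt t1 _ la_gt0.
  - exact: near_perturbation_size_gt0.
  - by apply: cvgr_lt t2 _ _; rewrite invr_gt0.
  - exact: cvgr_neq0 (hornerG _ _ mu_la) Pla.
  - apply: cvgr_neq0 NmP; apply: cvgD; first exact: hornerG.
    by apply: cvgM; [exact: cvg_cst|exact: hornerG].
have b_gt0 : 0 < g^-1 - m by rewrite subr_gt0 -[m]invrK ltf_pV2 ?posrE ?invr_gt0.
have {}stQ := stQ root_rho.
have muE : rho / g / (g^-1 - m) = mu (rho, g).
  rewrite /mu /=; have gb : g * (g^-1 - m) = 1 - g * m by rewrite mulrBr mulfV ?gt_eqF.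
  by rewrite -gb invfM mulrA.
have gb_gt0 : 0 < 1 - g * m.
  have -> : 1 - g * m = g * (g^-1 - m) by rewrite mulrBr mulfV ?gt_eqF.
  exact: mulr_gt0.
exists (((rho / g)%:P - (g^-1 - m) *: 'X) *
  ((la / rho) *: N + m *: perturbed d.+1 N P la rho g)), g^-1.
split; first by rewrite invr_eq0 gt_eqF.
  move=> y /val_gt0; rewrite /value /=; move: (perturbed _ _ _ _ _ _) => q val_y.
  rewrite hornerZ !hornerM !hornerD !hornerN !hornerZ !hornerC !hornerX.
  apply: ltW; rewrite -(pmulr_rgt0 _ (mulr_gt0 g_gt0 g_gt0)).
  congr (0 < _): val_y; field.
  by rewrite !gt_eqF.
have /= LE := perturbed_link (m := m) (b := g^-1 - m) szN szP
  (lt0r_neq0 rho_gt0) (lt0r_neq0 g_gt0) root_rho (subrK _ _).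
rewrite -LE.
apply: stable_link => //.
- by rewrite divr_gt0.
- have := perturbed_link_neq0 (m := m) (b := g^-1 - m) szN szP
    (lt0r_neq0 rho_gt0) (lt0r_neq0 g_gt0) root_rho (subrK _ _) (lt0r_neq0 b_gt0).
  rewrite muE => /(_ Pmu); apply.
  (* If the link vanished at la, then la - rho = la g m, and [root_cond] would become la g (N + m P)
     = 0 at rho. *)
  apply: contraNneq Nrho => mu_E.
  have rhoE : rho = la * (1 - g * m).
    by rewrite -mu_E /mu /= divfK // gt_eqF.
  have la_g : la * g != 0 by rewrite mulf_neq0 ?gt_eqF.
  apply/eqP; apply: (mulfI la_g); rewrite mulr0 -[RHS]root_rho.
  by rewrite [in la - rho]rhoE; ring.
- move=> w k' b' k'_neq0; rewrite /mass_at /= hornerD hornerN !hornerM hornerD hornerN hornerC.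
  by rewrite hornerZ hornerX mulr0 mul0r !subr0 mulrCA => /(mulfI k'_neq0).
- have [/= _ _ con0 _] := stQ.
  move: con0; move: (perturbed _ _ _ _ _ _) => q; rewrite /mass_at /= => con0.
  by rewrite hornerD hornerN !hornerM hornerX mul0r subr0 !hornerD con0 hornerZ; ring.
- apply: (stable_fixed_mass (con := mass_at 0 sigma)) => //.
    by move=> w; rewrite /mass_at /= hornerD hornerN hornerZ => ->; ring.
  have [/= _ _ con0 _] := stQ.
  by move: con0; rewrite /mass_at /= => con0; rewrite hornerD con0 hornerZ mulrDl.
Unshelve. all: by end_near. Qed.

End Levels.

(** * Adding an eigenvalue and raising multiplicities of larger ones *)

Section BlockedLevels.
Context {R : realType}.
Implicit Types (E N P Q : {poly R}) (ms : seq R)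
  (m k b nu x sigma rho g la v y : R) (z w : {poly R} * {poly R}).

(** Between two blocking links, the free mass G nu - G y > 0 makes the effective mass vanish at the
    next point y, and it absorbs the constraint at nu. *)
Lemma stable_blocking_links d E ms n N Q nu (nus : seq R) :
    let G y := N.[y] / Q.[y] in
    (forall y, y \in nu :: nus -> 0 < y /\ Q.[y] != 0) ->
    path (fun y1 y2 => G y2 < G y1) nu nus ->
    stable (realizable E ms n) (mass_at nu 0) d.+1 (N - G nu *: Q, Q) ->
  stable (realizable (E * \prod_(y <- nus) (y%:P - 'X)) ms (n + size nus)%N)
    (mass_at (last nu nus) 0) d.+1 (N - G (last nu nus) *: Q, Q).
Proof.
move=> G; elim: nus nu E n => [|y nus IH] nu E n nusP /=.
  by rewrite big_nil mulr1 addn0.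
move=> /andP[Gy pathG] st; rewrite big_cons mulrA addnS -addSn.
have [_ Qnu] := nusP nu (mem_head _ _).
have [y_gt0 Qy] : 0 < y /\ Q.[y] != 0.
  by apply: nusP; rewrite !inE eqxx orbT.
apply: (IH y) => // [y' y'_in|]; first by apply: nusP; rewrite inE y'_in orbT.
apply: stable_blocking_link => //.
  by rewrite hornerD hornerN hornerZ divfK // subrr.
have := stable_free_mass Qnu (_ : 0 < G nu - G y) st.
by rewrite subr_gt0 => /(_ Gy); rewrite scalerBl addrA subrK.
Qed.

(** Splitting 1 / g into an inertance rho v / g and a free mass (1 - rho v) / g puts the zero of the
    link at 1 / v. The parameter v is tuned so that the prescribed mass m in front makes the
    effective mass vanish at nu. At v = 1 / nu only the term in m is left, of sign opposite to
    P(nu); at v0, fixed before g, the other term dominates for small g. The intermediate value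
    theorem applies between them. *)
Lemma exists_tuning d N P la m nu (A : set (R * R * R)) :
    (size N <= d)%N -> (size P <= d)%N ->
    0 < la -> la < nu -> 0 < m -> P.[la] != 0 -> P.[nu] != 0 ->
    filter_prod (filter_prod (nbhs la) (0 : R)^'+) (nu^-1)^'- A ->
  exists rho g v, [/\ A (rho, g, v), root_cond N P la rho g &
    rho * (1 - v * nu) * (g * (la / rho) * N.[nu] +
      (1 - rho * v) * (perturbed d N P la rho g).[nu]) +
    g * m * P.[nu] * (la - nu) = 0].
Proof.
move=> szN szP la_gt0 la_nu m_gt0 Pla Pnu [[U V] /= [nU nV] UV].
have nu_gt0 : 0 < nu by exact: lt_trans la_nu.
pose G := filter_prod (nbhs la) (0 : R)^'+.
have t1 := @cvg_perturbation_freq R la; have t2 := @cvg_perturbation_size R la.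
have /nbhs_ballP[e /= e_gt0 eV] : nbhs nu^-1 (fun v => v < nu^-1 -> V v) by [].
pose v0 := nu^-1 - e / 2.
have e2_gt0 : 0 < e / 2 by rewrite divr_gt0.
have inV v : v0 <= v -> v < nu^-1 -> V v.
  move=> v0v vnu; apply: eV => //; rewrite /ball /= ger0_norm ?subr_ge0 ?ltW //.
  rewrite /v0 in v0v; lra.
pose value (t : R * R) := (t.1 * (1 - v0 * nu) * (t.2 * (la / t.1) * N.[nu] +
      (1 - t.1 * v0) * (perturbed d N P la t.1 t.2).[nu]) +
    t.2 * m * P.[nu] * (la - nu)) * P.[nu].
have valueG : value t @[t --> G] --> (la * (1 - v0 * nu) * (0 * (la / la) * N.[nu] +
      (1 - la * v0) * P.[nu]) + 0 * m * P.[nu] * (la - nu)) * P.[nu].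
  apply: cvgM; last exact: cvg_cst.
  apply: cvgD; last by do 3![apply: cvgM; last exact: cvg_cst].
  apply: cvgM; first by apply: cvgM => //; exact: cvg_cst.
  apply: cvgD.
    apply: cvgM; last exact: cvg_cst.
    apply: cvgM => //; apply: cvgM; first exact: cvg_cst.
    by apply: cvgV => //; rewrite gt_eqF.
  apply: cvgM; last exact: cvg_perturbed.
  by apply: cvgB; [exact: cvg_cst|apply: cvgM => //; exact: cvg_cst].
have lim_gt0 : 0 < (la * (1 - v0 * nu) * (0 * (la / la) * N.[nu] +
      (1 - la * v0) * P.[nu]) + 0 * m * P.[nu] * (la - nu)) * P.[nu].
  have v0nu : 1 - v0 * nu = e / 2 * nu by rewrite /v0 mulrBl mulVf ?gt_eqF //; ring.
  have v0la : 0 < 1 - la * v0.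
    rewrite subr_gt0 /v0 mulrBr ltrBlDr (@lt_le_trans _ _ 1) //.
      by rewrite ltr_pdivrMr ?mul1r.
    by rewrite lerDl mulr_ge0 // ltW.
  rewrite v0nu !mul0r add0r addr0 -mulrA -[_ * P.[nu] * P.[nu]]mulrA -expr2.
  apply: mulr_gt0; first by rewrite mulr_gt0 // mulr_gt0.
  by apply: mulr_gt0 => //; rewrite exprn_even_gt0.
have /(exists_root_cond N la_gt0 Pla)[rho [g [[Urg val_gt0 rho_gt0 g_gt0] root_rho]]] :
    G (fun t => [/\ U t, 0 < value t, 0 < t.1 & 0 < t.2]).
  near=> t; split; near: t => //.
  - exact: cvgr_gt valueG _ lim_gt0.
  - exact: cvgr_gt t1 _ la_gt0.
  - exact: near_perturbation_size_gt0.
rewrite /value /= in val_gt0 rho_gt0 g_gt0.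
set q := (perturbed d N P la rho g).[nu] in val_gt0.
pose hp : {poly R} := - P.[nu] *: ((rho *: (1 - nu *: 'X)) *
  ((g * (la / rho) * N.[nu])%:P + q *: (1 - rho *: 'X)) +
  (g * m * P.[nu] * (la - nu))%:P).
have hpE v : hp.[v] = - ((rho * (1 - v * nu) * (g * (la / rho) * N.[nu] +
      (1 - rho * v) * q) + g * m * P.[nu] * (la - nu)) * P.[nu]).
  rewrite /hp hornerZ hornerD hornerM !(hornerZ, hornerD, hornerN, hornerC, hornerX).
  ring.
have [||v /andP[v0v vnu] /rootP hv] := @poly_ivt R hp v0 nu^-1.
- by rewrite /v0 lerBlDr lerDl ltW.
- rewrite !hpE mulVf ?gt_eqF // subrr mulr0 mul0r add0r; apply/andP; split.
    by rewrite oppr_le0 ltW.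
  have -> : - (g * m * P.[nu] * (la - nu) * P.[nu]) =
    g * m * (P.[nu] ^+ 2 * (nu - la)) by ring.
  by apply: mulr_ge0; apply: mulr_ge0; rewrite ?sqr_ge0 ?subr_ge0 ?ltW.
have value0 : (rho * (1 - v * nu) * (g * (la / rho) * N.[nu] + (1 - rho * v) * q) +
    g * m * P.[nu] * (la - nu)) = 0.
  by move/eqP: hv; rewrite hpE oppr_eq0 mulf_eq0 (negPf Pnu) orbF => /eqP.
exists rho, g, v; split=> //; apply: UV; split=> //=; apply: inV => //.
rewrite lt_neqAle vnu andbT; apply/eqP => v_nu; move/eqP: value0.
rewrite v_nu mulVf ?(lt0r_neq0 nu_gt0) // subrr mulr0 mul0r add0r.
by rewrite !mulf_eq0 (negPf Pnu) subr_eq0 (gt_eqF g_gt0) (gt_eqF m_gt0) (lt_eqF la_nu).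
Unshelve. all: by end_near. Qed.

(** The free resonating mass removes the constraint before the wall link is put, and the tuned link
    makes N' / Q' equal to - m at nu. Blocking then continues downwards from nu, because N' / Q'
    increases with y on the blocking points. *)
Lemma stable_blocked_level d E ms n x sigma N P la m nu (nus : seq R) :
    0 < la -> 0 < m -> x = 0 \/ sigma = 0 -> P.[x] != 0 -> P.[la] != 0 ->
    (forall y, y \in nu :: nus -> la < y /\ P.[y] != 0) ->
    path (fun y1 y2 => y2 < y1) nu nus ->
    stable (realizable E ms n) (mass_at x sigma) d.+1 (N, P) ->
  exists N' a, a != 0 /\
    stable (realizable (E * \prod_(y <- nu :: nus) (y%:P - 'X)) (m :: ms)
             (n + (size (nu :: nus)).+1)%N)
      (mass_at (last nu nus) 0) d.+2 (N', a *: (P * (la%:P - 'X))).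
Proof.
move=> la_gt0 m_gt0 x_sigma Px Pla nusP nus_path stNP.
have [/= szN szP _ _] := stNP.
have [la_nu Pnu] := nusP nu (mem_head _ _).
have nu_gt0 : 0 < nu by exact: lt_trans la_nu.
have nuV_gt0 : 0 < nu^-1 by rewrite invr_gt0.
pose F := filter_prod (filter_prod (nbhs la) (0 : R)^'+) (nu^-1)^'-.
have cvgF1 : t.1 @[t --> F] --> filter_prod (nbhs la) (0 : R)^'+ by exact: cvg_fst.
have t1 : t.1.1 @[t --> F] --> la.
  exact: (cvg_comp _ _ cvgF1 (@cvg_perturbation_freq R la)).
have t2 : t.1.2 @[t --> F] --> (0 : R).
  exact: (cvg_comp _ _ cvgF1 (@cvg_perturbation_size R la)).
have tv : t.2 @[t --> F] --> nu^-1.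
  by apply: cvg_trans (cvg_snd (G := (nu^-1)^'-)) _; exact: cvg_within.
have tq y : (perturbed d.+1 N P la t.1.1 t.1.2).[y] @[t --> F] --> P.[y].
  exact: (cvg_comp _ _ cvgF1 (cvg_perturbed (y := y) szN szP la_gt0)).
pose value y (t : R * R * R) := t.1.1 * (1 - t.2 * y) *
  (t.1.2 * (la / t.1.1) * N.[y] +
     (1 - t.1.1 * t.2) * (perturbed d.+1 N P la t.1.1 t.1.2).[y]) / (P.[y] * (la - y)).
pose lim_value y := la * (1 - nu^-1 * y) *
    (0 * (la / la) * N.[y] + (1 - la * nu^-1) * P.[y]) / (P.[y] * (la - y)).
have valueF y : value y t @[t --> F] --> lim_value y.
  apply: cvgM; last exact: cvg_cst.
  apply: cvgM.
    apply: cvgM => //; apply: cvgB; first exact: cvg_cst.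
    by apply: cvgM => //; exact: cvg_cst.
  apply: cvgD.
    apply: cvgM; last exact: cvg_cst.
    apply: cvgM => //; apply: cvgM; first exact: cvg_cst.
    by apply: cvgV => //; rewrite gt_eqF.
  apply: cvgM; last exact: tq.
  by apply: cvgB; [exact: cvg_cst|exact: cvgM].
have near_value : \forall t \near F, forall y1, y1 \in nu :: nus ->
    forall y2, y2 \in nu :: nus -> y2 < y1 -> 0 < value y1 t - value y2 t.
  apply: near_all_seq => y1 /nusP[la_y1 Py1].
  apply: near_all_seq => y2 /nusP[la_y2 Py2].
  have [y21|_] := ltP y2 y1; last exact: nearW.
  have lim12 : value y1 t - value y2 t @[t --> F] --> lim_value y1 - lim_value y2.
    exact: cvgB.
  near=> t => _; near: t; apply: cvgr_gt lim12 _ _.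
  (* P cancels in [lim_value y], leaving la (nu - la) (nu - y) / (nu^2 (la - y)), which increases
     with y above la. *)
  have -> : lim_value y1 - lim_value y2 =
      la * ((nu - la) / nu) ^+ 2 * ((y1 - y2) / ((y1 - la) * (y2 - la))).
    rewrite /lim_value; field; rewrite Py1 Py2 !subr_eq0.
    rewrite (gt_eqF la_y1) (gt_eqF la_y2) (lt_eqF la_y1) (lt_eqF la_y2).
    by rewrite (gt_eqF nu_gt0) (gt_eqF la_gt0).
  apply: mulr_gt0.
    by rewrite mulr_gt0 // exprn_even_gt0 //= gt_eqF // divr_gt0 // subr_gt0.
  by rewrite divr_gt0 ?mulr_gt0 // subr_gt0.
have near_st : \forall t \near F, root_cond N P la t.1.1 t.1.2 ->
    stable (realizable E ms n) (mass_at x sigma) d.+1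
      ((la / t.1.1) *: N, perturbed d.+1 N P la t.1.1 t.1.2).
  exact: cvgF1 (stable_perturbed la_gt0 x_sigma stNP).
have [|rho [g [v [[/= stQ val_gt0 [rho_gt0 g_gt0 v_gt0] [rhov Q1x Pv v_la]] root_rho tuned]]]] :=
  @exists_tuning d.+1 N P la m nu (fun t => [/\ root_cond N P la t.1.1 t.1.2 ->
    stable (realizable E ms n) (mass_at x sigma) d.+1
      ((la / t.1.1) *: N, perturbed d.+1 N P la t.1.1 t.1.2),
    forall y1, y1 \in nu :: nus -> forall y2, y2 \in nu :: nus -> y2 < y1 ->
      0 < value y1 t - value y2 t,
    [/\ 0 < t.1.1, 0 < t.1.2 & 0 < t.2] &
    [/\ 0 < 1 - t.1.1 * t.2,
        (perturbed d.+1 N P la t.1.1 t.1.2).[x] != 0, P.[t.2^-1] != 0 & t.2^-1 - la != 0]])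
    szN szP la_gt0 la_nu m_gt0 Pla Pnu.
  have tvV : t.2^-1 @[t --> F] --> nu^-1^-1 by apply: cvgV => //; rewrite gt_eqF.
  rewrite invrK in tvV.
  have t1v : 1 - t.1.1 * t.2 @[t --> F] --> 1 - la * nu^-1.
    by apply: cvgB; [exact: cvg_cst|exact: cvgM].
  have tvla : t.2^-1 - la @[t --> F] --> nu - la by apply: cvgB => //; exact: cvg_cst.
  near=> t; split; try by near: t.
  - split; near: t.
    + exact: cvgr_gt t1 _ la_gt0.
    + exact: cvgF1 (near_perturbation_size_gt0 la).
    + exact: cvgr_gt tv _ nuV_gt0.
  - split; near: t.
    + by apply: cvgr_gt t1v _ _; rewrite subr_gt0 ltr_pdivrMr // mul1r.
    + exact: cvgr_neq0 (tq x) Px.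
    + exact: cvgr_neq0 (cvg_horner (pcvg_cst (leqnn _)) tvV) Pnu.
    + by apply: cvgr_neq0 tvla _; rewrite subr_eq0 gt_eqF.
have {}stQ := stQ root_rho.
pose X := (1 - rho * v) / g; pose b := rho * v / g.
have X_gt0 : 0 < X by rewrite divr_gt0.
have b_gt0 : 0 < b by rewrite divr_gt0 ?mulr_gt0.
have bX : b + X = g^-1 by rewrite /b /X; ring.
have bmu : rho / g / b = v^-1 by rewrite /b; field; rewrite !gt_eqF.
have /= LE := perturbed_link szN szP (lt0r_neq0 rho_gt0) (lt0r_neq0 g_gt0) root_rho bX.
have /= NE := perturbed_link_neq0 szN szP (lt0r_neq0 rho_gt0) (lt0r_neq0 g_gt0)
  root_rho bX (lt0r_neq0 b_gt0).
rewrite subr_eq0 in v_la; rewrite bmu in NE; have {}NE := NE Pv v_la.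
have /= st1 := stable_free_mass Q1x X_gt0 stQ.
have := @stable_link R d E ms n (@unconstrained R) _ _ (rho / g) b
  (divr_gt0 rho_gt0 g_gt0) b_gt0 _ (fun _ _ _ _ _ => I) I st1.
rewrite bmu LE => /(_ NE).
set N' := (_ * _ : {poly R}); set Q' := g^-1 *: _ => st2.
have st3 := stable_fixed_mass m_gt0 (fun _ _ => I) I st2 (con' := @unconstrained R).
have QE y : Q'.[y] = g^-1 * (P.[y] * (la - y)).
  by rewrite /Q' hornerZ hornerM hornerD hornerN hornerC hornerX.
have Qy y : y \in nu :: nus -> Q'.[y] != 0.
  move=> /nusP[la_y Py]; rewrite QE mulf_neq0 ?invr_eq0 ?mulf_neq0 ?subr_eq0 //.
    by rewrite gt_eqF.
  by rewrite lt_eqF.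
have NE' y : N'.[y] = rho / g * (1 - v * y) * ((la / rho) * N.[y] +
    X * (perturbed d.+1 N P la rho g).[y]).
  rewrite /N' hornerM !hornerD hornerN !hornerZ hornerC hornerX /b; ring.
have GE y : y \in nu :: nus -> N'.[y] / Q'.[y] = g^-1 * value y (rho, g, v).
  move=> /nusP[la_y Py]; rewrite NE' QE /value /X /=; field.
  by rewrite Py subr_eq0 (lt_eqF la_y) !gt_eqF.
have Nnu : (N' + m *: Q').[nu] = 0.
  rewrite hornerD hornerZ NE' QE.
  have -> : rho / g * (1 - v * nu) * (la / rho * N.[nu] +
      X * (perturbed d.+1 N P la rho g).[nu]) + m * (g^-1 * (P.[nu] * (la - nu))) =
    g^-1 ^+ 2 * (rho * (1 - v * nu) * (g * (la / rho) * N.[nu] +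
      (1 - rho * v) * (perturbed d.+1 N P la rho g).[nu]) +
      g * m * P.[nu] * (la - nu)).
    by rewrite /X; field; rewrite !gt_eqF.
  by rewrite tuned mulr0.
have st4 := stable_blocking_link nu_gt0 Nnu st3.
have mE : N' + m *: Q' = N' - (N'.[nu] / Q'.[nu]) *: Q'.
  rewrite -scaleNr; congr (_ + _ *: _); apply/eqP; rewrite -addr_eq0; apply/eqP.
  move/eqP: Nnu; rewrite hornerD hornerZ addr_eq0 => /eqP ->.
  by rewrite mulNr mulfK ?subrr // Qy // mem_head.
rewrite mE in st4.
exists (N' - (N'.[last nu nus] / Q'.[last nu nus]) *: Q'), g^-1.
split; first by rewrite invr_eq0 gt_eqF.
rewrite big_cons mulrA addnS -addSn /= addnS -addSn.
apply: (stable_blocking_links (N := N')) st4.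
  by move=> y y_in; split; [have [+ _] := nusP y y_in; exact: lt_trans|exact: Qy].
have : path (fun y1 y2 => [&& y1 \in nu :: nus, y2 \in nu :: nus & y2 < y1]) nu nus.
  apply: (sub_in_path (P := mem (nu :: nus)) _ _ nus_path) => [y1 y2 y1_in y2_in y21|].
    by apply/and3P.
  by apply/allP.
apply: sub_path => y1 y2 /and3P[y1_in y2_in y21].
rewrite !GE // ltr_pM2l ?invr_gt0 // -subr_gt0; exact: val_gt0.
Unshelve. all: by end_near. Qed.

End BlockedLevels.

(** * Adding all the eigenvalues *)

Section Schedules.
Context {R : realType}.

(* An entry [(la, m, nus)] adds the eigenvalue [la] and the prescribed mass   *)
(* [m], and raises the multiplicities of the eigenvalues [nus].               *)
Definition entry_ok (e : R * R * seq R) : bool :=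
  [&& 0 < e.1.1, 0 < e.1.2, sorted (fun y1 y2 => y2 < y1) e.2 & all (> e.1.1) e.2].

(** This keeps the current characteristic polynomial nonzero at every point still to be added or
    blocked. *)
Definition fresh (e e' : R * R * seq R) : bool := e.1.1 \notin e'.1.1 :: e'.2.

Definition spectrum (l : seq (R * R * seq R)) : {poly R} :=
  \prod_(e <- l) (e.1.1%:P - 'X).

Definition raised (l : seq (R * R * seq R)) : {poly R} :=
  \prod_(e <- l) \prod_(y <- e.2) (y%:P - 'X).

Lemma freshP (e e' : R * R * seq R) y : fresh e e' -> y \in e'.1.1 :: e'.2 -> y != e.1.1.
Proof. by move=> ee' y_in; apply: contraNneq ee' => <-. Qed.

Lemma horner_level (P : {poly R}) (a la y : R) :
  (a *: (P * (la%:P - 'X))).[y] = a * (P.[y] * (la - y)).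
Proof. by rewrite hornerZ hornerM hornerD hornerN hornerC hornerX. Qed.

(** Each level leaves a constraint at its last blocking point, which the free mass of the next level
    absorbs; [eZ], with nothing to raise, is added by [realizable_wall_mass]. *)
Lemma blocked_schedule (l : seq (R * R * seq R)) eZ E ms n d x sigma (N P : {poly R}) :
    all entry_ok (rcons l eZ) -> pairwise fresh (rcons l eZ) ->
    all (fun e => e.2 != [::]) l -> eZ.2 = [::] ->
    x = 0 \/ sigma = 0 -> P.[x] != 0 ->
    (forall e, e \in rcons l eZ -> forall y, y \in e.1.1 :: e.2 -> P.[y] != 0) ->
    stable (realizable E ms n) (mass_at x sigma) d.+1 (N, P) ->
  exists N' c, c != 0 /\
    realizable (E * raised l) (eZ.1.2 :: catrev [seq e.1.2 | e <- l] ms)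
      (n + \sum_(e <- rcons l eZ) (size e.2).+1)%N (N', c *: (P * spectrum (rcons l eZ))).
Proof.
move=> ok_l fresh_l S_l SZ; elim: l ok_l fresh_l S_l E ms n d x sigma N P =>
    [|[[la m] [//|nu nus]] l IH] /=.
  rewrite !andbT => ok_Z _ _ E ms n d x sigma N P x_sigma Px Pl st.
  have /and4P[la_gt0 m_gt0 _ _] := ok_Z.
  have Pla : P.[eZ.1.1] != 0 by apply: (Pl eZ); rewrite ?mem_head ?inE ?eqxx.
  have [N' [a [a_neq0 real_N]]] := realizable_wall_mass la_gt0 m_gt0 x_sigma Pla st.
  exists N', a; split=> //.
  by rewrite /raised /spectrum big_nil mulr1 !big_seq1 SZ addn1.
move=> /andP[/and4P[/= la_gt0 m_gt0 nus_path nus_la] ok_l] /andP[/allP fr fresh_l] S_l.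
move=> E ms n d x sigma N P x_sigma Px Pl st.
have P_head y : y \in la :: nu :: nus -> P.[y] != 0.
  by apply: (Pl (la, m, nu :: nus)); rewrite mem_head.
have nusP y : y \in nu :: nus -> la < y /\ P.[y] != 0.
  move=> y_in; split; first exact: (@allP _ (> la) (nu :: nus) nus_la).
  by apply: P_head; rewrite inE y_in orbT.
have Pla : P.[la] != 0 by apply: P_head; rewrite mem_head.
have [N' [a [a_neq0 st']]] :=
  stable_blocked_level la_gt0 m_gt0 x_sigma Px Pla nusP nus_path st.
have [|||N2 [c [c_neq0 real2]]] := IH ok_l fresh_l S_l _ _ _ _ _ _ _ _ _ _ _ st'.
- by right.
- have [la_last P_last] := nusP _ (mem_last nu nus).
  by rewrite horner_level !mulf_neq0 // subr_eq0 lt_eqF.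
- move=> e e_in y y_in; rewrite horner_level !mulf_neq0 //.
    by apply: (Pl e) y_in; rewrite inE e_in orbT.
  by rewrite subr_eq0 eq_sym (freshP (fr e e_in)).
exists N2, (c * a); split; first by rewrite mulf_neq0.
rewrite /raised /spectrum !big_cons.
congr (realizable _ _ _ (_, _)): real2.
- by rewrite /raised [in LHS]big_cons !mulrA.
- by rewrite addnA.
- by rewrite -scalerAl scalerA mulrA.
Qed.

(** Levels without blocking come first: [stable_wall_mass] takes its constraint at 0, and a blocked
    level moves the constraint to a blocking point. *)
Lemma simple_schedule (l : seq (R * R * seq R)) eZ E ms n d sigma (N P : {poly R}) :
    all entry_ok (rcons l eZ) -> pairwise fresh (rcons l eZ) ->
    sorted (fun e e' => (e.2 != [::]) ==> (e'.2 != [::])) l -> eZ.2 = [::] ->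
    P.[0] != 0 ->
    (forall e, e \in rcons l eZ -> forall y, y \in e.1.1 :: e.2 ->
       P.[y] != 0 /\ 0 <= N.[y] * P.[y]) ->
    stable (realizable E ms n) (mass_at 0 sigma) d.+1 (N, P) ->
  exists N' c, c != 0 /\
    realizable (E * raised l) (eZ.1.2 :: catrev [seq e.1.2 | e <- l] ms)
      (n + \sum_(e <- rcons l eZ) (size e.2).+1)%N (N', c *: (P * spectrum (rcons l eZ))).
Proof.
elim: l E ms n d sigma N P => [|[[la m] nus] l IH] E ms n d sigma N P ok_l fresh_l S_l SZ P0 Pl st.
  by apply: blocked_schedule st => //; [left|move=> e e_in y /(Pl e e_in)[]].
have [nus0|nus_neq0] := eqVneq nus [::]; last first.
  apply: blocked_schedule st => //; [|by left|by move=> e e_in y /(Pl e e_in)[]].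
  move: S_l; rewrite /= => S_l; rewrite nus_neq0 /=.
  have trS : transitive (fun e e' : R * R * seq R => (e.2 != [::]) ==> (e'.2 != [::])).
    by move=> e1 e2 e3 /implyP H1 /implyP H2; apply/implyP => /H1.
  by have := order_path_min trS S_l; rewrite /= nus_neq0.
move: ok_l fresh_l; rewrite rcons_cons nus0 /= => /andP[/and4P[/= la_gt0 m_gt0 _ _] ok_l].
move=> /andP[/allP fr fresh_l].
have [Pla NPla] : P.[la] != 0 /\ 0 <= N.[la] * P.[la].
  by apply: (Pl (la, m, nus)); rewrite mem_head.
pose ys := flatten [seq e.1.1 :: e.2 | e <- rcons l eZ].
have ysP y : y \in ys -> [/\ y != la, P.[y] != 0 & 0 <= N.[y] * P.[y]].
  move=> /flattenP[_ /mapP[e e_in ->] y_in].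
  have [] // := Pl e _ y y_in; first by rewrite inE e_in orbT.
  by split=> //; exact: (freshP (fr e e_in)).
have [N' [a [a_neq0 NP' st']]] := stable_wall_mass la_gt0 m_gt0 Pla NPla ysP st.
have [|||N2 [c [c_neq0 real2]]] := IH _ _ _ _ _ _ _ ok_l fresh_l _ SZ _ _ st'.
- exact: path_sorted S_l.
- by rewrite horner_level !mulf_neq0 // subr0 gt_eqF.
- move=> e e_in y y_in.
  have y_ys : y \in ys by apply/flattenP; exists (e.1.1 :: e.2) => //; exact: map_f.
  have [y_la Py _] := ysP y y_ys; split; last exact: NP'.
  by rewrite horner_level !mulf_neq0 // subr_eq0 eq_sym.
exists N2, (c * a); split; first by rewrite mulf_neq0.
rewrite /raised /spectrum !big_cons /= big_nil mul1r add1n addnS -addSn.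
by congr (realizable _ _ _ (_, _)): real2; rewrite -scalerAl scalerA mulrA.
Qed.

Lemma stable_empty_chain : stable (realizable 1 [::] 0) (mass_at 0 0) 1 ((0, 1) : {poly R} * {poly R}).
Proof.
split=> /=; rewrite ?size_poly0 ?size_poly1 //.
  by rewrite /mass_at /= horner0 mul0r.
set z : {poly R} * {poly R} := (0, 1).
have sz1 : poly_nbhs 1 z (fun w => (size w.1 <= 1)%N).
  by have [] := pcvg_fst (z := z) (d := 1); rewrite /= size_poly0.
have snd1 : pcvg (poly_nbhs 1 z) 1 snd 1 by apply: (pcvg_snd (z := z)); rewrite size_poly1.
have sz2 : poly_nbhs 1 z (fun w => (size w.2 <= 1)%N) by have [] := snd1.
have w2_0 : w.2.[0] @[w --> poly_nbhs 1 z] --> (1 : {poly R}).[0].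
  exact: cvg_horner snd1 (cvg_cst 0).
have near2 : \forall w \near poly_nbhs 1 z, w.2.[0] != 0.
  by apply: cvgr_neq0 w2_0 _; rewrite hornerC oner_neq0.
near=> w; rewrite /mass_at mul0r => w10.
have szw1 : (size w.1 <= 1)%N by near: w.
have szw2 : (size w.2 <= 1)%N by near: w.
have w2_neq0 : w.2.[0] != 0 by near: w.
have w1E : w.1 = 0.
  by rewrite (size1_polyC szw1) -horner_coef0 w10.
have w2E : w.2 = (w.2.[0])%:P by rewrite {1}(size1_polyC szw2) -horner_coef0.
exists [::], w.2.[0]^-1, [::]; split; rewrite ?invr_eq0 //=.
rewrite w1E {2}w2E mul0r mulr0 scaler0 mulr1 -mul_polyC -polyCM mulVf //.
Unshelve. all: by end_near. Qed.

Lemma schedule_chain (l : seq (R * R * seq R)) eZ :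
    all entry_ok (rcons l eZ) -> pairwise fresh (rcons l eZ) ->
    sorted (fun e e' => (e.2 != [::]) ==> (e'.2 != [::])) l -> eZ.2 = [::] ->
  exists L r c, [/\ admissible L, size L = (\sum_(e <- rcons l eZ) (size e.2).+1)%N,
    perm_eq [seq mass u | u <- L] (rev [seq e.1.2 | e <- rcons l eZ] ++ r) &
    (transfer L).1 = c *: (spectrum (rcons l eZ) * raised (rcons l eZ))].
Proof.
move=> ok_l fresh_l S_l SZ.
have [||N [c [c_neq0]]] := simple_schedule ok_l fresh_l S_l SZ _ _ stable_empty_chain.
- by rewrite hornerC oner_neq0.
- by move=> e _ y _; rewrite hornerC horner0 mul0r oner_neq0.
rewrite add0n !mul1r => -[L [c' [r [admL szL pL c'_neq0 tL]]]].
exists L, r, (c' * c); split=> //.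
  by rewrite map_rcons rev_rcons.
by rewrite tL /= -scalerAl scalerA /raised big_rcons /= SZ big_nil mulr1.
Qed.

End Schedules.

(** * Order of the eigenvalues *)

Section Ordering.
Context {m : nat} (t : 'I_m -> nat).
Context (t_gt0 : forall i, (0 < t i)%N) (t_le : forall i, (t i <= i.+1)%N).

Definition simple_eig (i : 'I_m) : bool := (t i <= 1)%N.

Definition eig_order : seq 'I_m :=
  rev [seq i <- enum 'I_m | simple_eig i] ++ [seq i <- enum 'I_m | ~~ simple_eig i].

Local Notation pos i := (index i eig_order).

Lemma perm_eig_order : perm_eq eig_order (enum 'I_m).
Proof.
apply: perm_trans (permEl (perm_filterC simple_eig (enum 'I_m))).
by rewrite perm_cat2r perm_rev.
Qed.

Lemma mem_eig_order i : i \in eig_order.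
Proof. by rewrite (perm_mem perm_eig_order) mem_enum. Qed.

Lemma uniq_eig_order : uniq eig_order.
Proof. by rewrite (perm_uniq perm_eig_order) enum_uniq. Qed.

Lemma size_eig_order : size eig_order = m.
Proof. by rewrite (perm_size perm_eig_order) size_enum_ord. Qed.

Lemma pos_lt i : (pos i < m)%N.
Proof. by rewrite -[X in (_ < X)%N]size_eig_order index_mem mem_eig_order. Qed.

Lemma pos_inj : injective (fun i => pos i).
Proof.
move=> i j /= ij; rewrite -[i](nth_index i (mem_eig_order i)).
by rewrite ij nth_index ?mem_eig_order.
Qed.

Lemma pairwise_enum_ord : pairwise (fun i j : 'I_m => (i < j)%N) (enum 'I_m).
Proof.
rewrite -(pairwise_map val ltn) val_enum_ord -sorted_pairwise; last exact: ltn_trans.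
exact: iota_ltn_sorted.
Qed.

Lemma eig_order_lt i j : (pos i < pos j)%N ->
  if simple_eig j then simple_eig i && (j < i)%N else simple_eig i || (i < j)%N.
Proof.
pose r (i j : 'I_m) := if simple_eig j then simple_eig i && (j < i)%N
  else simple_eig i || (i < j)%N.
have pw : pairwise r eig_order.
  rewrite pairwise_cat; apply/and3P; split.
  - apply/allrelP => x y; rewrite mem_rev !mem_filter => /andP[sx _] /andP[sy _].
    by rewrite /r (negPf sy) sx.
  - have : pairwise (fun i j : 'I_m => (i < j)%N) [seq i <- enum 'I_m | simple_eig i].
      exact: pairwise_filter pairwise_enum_ord.
    have : all simple_eig [seq i <- enum 'I_m | simple_eig i] by exact: filter_all.
    elim: [seq i <- enum 'I_m | simple_eig i] => //= x s IH /andP[sx ss] /andP[xs pw].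
    rewrite rev_cons -cats1 pairwise_cat IH //= andbT allrel1r.
    apply/allP => y; rewrite mem_rev => ys.
    by rewrite /r sx (allP ss) // (allP xs).
  - have : pairwise (fun i j : 'I_m => (i < j)%N) [seq i <- enum 'I_m | ~~ simple_eig i].
      exact: pairwise_filter pairwise_enum_ord.
    apply: sub_in_pairwise (filter_all _ _) => x y _ /negPf sy xy.
    by rewrite /r sy xy orbT.
move=> ij; have /(pairwiseP i) := pw => /(_ (pos i) (pos j)).
by rewrite !nth_index ?mem_eig_order //; apply; rewrite ?inE ?index_mem ?mem_eig_order.
Qed.

Lemma pos_lt_multiple (i k : 'I_m) : ~~ simple_eig i -> (k < i)%N -> (pos k < pos i)%N.
Proof.
move=> si ki; have [ik|//|/pos_inj ik] := ltngtP (pos i) (pos k); last first.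
  by rewrite ik ltnn in ki.
have := eig_order_lt ik; rewrite (negPf si) /=; case: ifP => // _ ik'.
by have := ltn_trans ki ik'; rewrite ltnn.
Qed.

Lemma leq_pos_range (i : 'I_m) a b :
  (forall k : 'I_m, (k < i)%N -> (a <= pos k < b)%N) -> (i <= b - a)%N.
Proof.
move=> ab; pose f (k : 'I_i) : nat := pos (widen_ord (ltnW (ltn_ord i)) k).
have f_inj : injective f by move=> k l /pos_inj /(congr1 val) /= kl; exact: val_inj.
have := @uniq_leq_size _ [seq f k | k <- enum 'I_i] (iota a (b - a)).
rewrite size_map size_iota size_enum_ord; apply.
  by rewrite map_inj_uniq ?enum_uniq.
move=> _ /mapP[k _ ->]; rewrite mem_iota.
have /andP[ak kb] : (a <= f k < b)%N by apply: ab => /=; exact: ltn_ord.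
by rewrite ak subnKC // (leq_trans ak) // ltnW.
Qed.

(* After the eigenvalue [j] has been added, the multiplicity of [i] is raised *)
(* when [i] is one of the next [t i - 1] eigenvalues that follow [j].         *)
Definition raises (j i : 'I_m) : bool := (pos i - (t i).-1 <= pos j < pos i)%N.

Lemma raises_multiple i j : raises j i -> ~~ simple_eig i.
Proof. by rewrite /raises /simple_eig => /andP[]; have := t_gt0 i; lia. Qed.

(** The bound on [t] enters here. If j were simple with i < j, every k < i would come strictly
    between j and i: simple ones follow j in decreasing order, multiple ones follow all simple ones,
    and all precede the multiple i. But at most t i - 2 < i places lie between them. *)
Lemma raises_lt i j : raises j i -> (j < i)%N.
Proof.
move=> ji; have si := raises_multiple ji.
have /andP[le_ij lt_ji] := ji.
have := eig_order_lt lt_ji; rewrite (negPf si) => /orP[sj|//].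
rewrite ltnNge; apply/negP; rewrite leq_eqVlt => /predU1P[/val_inj ij|lt_ij].
  by rewrite ij ltnn in lt_ji.
have : (i <= pos i - (pos j).+1)%N.
  apply: leq_pos_range => k ki; rewrite (pos_lt_multiple si ki) andbT.
  have [//|kj|/pos_inj jk] := ltngtP (pos j) (pos k).
    have := eig_order_lt kj; rewrite sj => /andP[_ jk].
    by have := ltn_trans (ltn_trans ki lt_ij) jk; rewrite ltnn.
  by have := ltn_trans ki lt_ij; rewrite jk ltnn.
have := t_le i; have := t_gt0 i; lia.
Qed.

(** The i eigenvalues below a multiple one precede it, so t i - 1 <= i <= [pos i] and the
    subtraction in [raises] is not truncated. *)
Lemma count_raises i : count (raises^~ i) (enum 'I_m) = (t i).-1.
Proof.
rewrite -(permP perm_eig_order).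
have e_le : ((t i).-1 <= pos i)%N.
  have [si|si] := boolP (simple_eig i); first by move: si; rewrite /simple_eig; lia.
  have : (i <= pos i - 0)%N.
    by apply: leq_pos_range => k ki; rewrite (pos_lt_multiple si ki).
  by have := t_le i; lia.
pose P p := (pos i - (t i).-1 <= p < pos i)%N.
have -> : count (raises^~ i) eig_order = count P [seq pos j | j <- eig_order].
  by rewrite count_map.
have -> : [seq pos j | j <- eig_order] = iota 0 m.
  apply: (@eq_from_nth _ 0%N); rewrite ?size_map ?size_iota ?size_eig_order // => p pm.
  rewrite (nth_map i) ?size_eig_order // nth_iota // add0n.
  by rewrite index_uniq ?size_eig_order ?uniq_eig_order.
have pm := pos_lt i; set p := pos i in e_le P pm *; set e := (t i).-1 in e_le P *.
have -> : m = ((p - e) + e + (m - p))%N by lia.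
rewrite !iotaD !count_cat !add0n.
have -> : count P (iota 0 (p - e)) = 0%N.
  apply/eqP; rewrite eqn0Ngt -has_count; apply/hasPn => q; rewrite mem_iota /P; lia.
have -> : count P (iota (p - e) e) = e.
  rewrite -[RHS](size_iota (p - e) e); apply/eqP; rewrite -all_count.
  by apply/allP => q; rewrite mem_iota /P; lia.
have -> : count P (iota (p - e + e) (m - p)) = 0%N.
  apply/eqP; rewrite eqn0Ngt -has_count; apply/hasPn => q; rewrite mem_iota /P; lia.
by rewrite addn0.
Qed.

(** This yields the sortedness required by [simple_schedule]. When j' is i itself, the eigenvalue
    after it is again multiple, so j' raises that one. *)
Lemma raises_next (j j' : 'I_m) i : raises j i -> pos j' = (pos j).+1 ->
  (pos j' < m.-1)%N -> exists i', raises j' i'.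
Proof.
move=> ji jj' j'm; have si := raises_multiple ji; have /andP[le_ij lt_ji] := ji.
have [lt_j'i|le_ij'] := ltnP (pos j') (pos i).
  by exists i; rewrite /raises lt_j'i andbT (leq_trans le_ij) // jj'.
have pi : pos i = pos j' by apply/eqP; rewrite eqn_leq le_ij' jj' lt_ji.
pose i' := nth i eig_order (pos j').+1.
have pi' : pos i' = (pos j').+1.
  by rewrite index_uniq ?uniq_eig_order // size_eig_order; lia.
have := @eig_order_lt i i'; rewrite pi pi' ltnSn => /(_ isT).
rewrite (negPf si) /=; case: ifP => // si' _; exists i'.
by move: si'; rewrite /raises pi' /simple_eig; lia.
Qed.

End Ordering.

(** * Counting multiplicities and assembling the chain *)

Lemma prod_filter_count (T : comNzRingType) (I J : eqType) (r : seq I) (s : seq J)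
    (B : I -> J -> bool) (F : J -> T) :
  \prod_(i <- r) \prod_(j <- s | B i j) F j =
  \prod_(j <- s) F j ^+ count (B^~ j) r.
Proof.
under eq_bigr do rewrite big_mkcond.
rewrite exchange_big; apply: eq_bigr => j _ /=.
by rewrite -big_mkcond big_const_seq iter_mulr_1.
Qed.

(** Extracts from the permutation of masses the distinct positions of the prescribed ones. *)
Lemma perm_cat_choice (T : eqType) (x0 : T) (I : eqType) (f : I -> T)
    (s : seq I) (r u : seq T) :
    uniq s -> perm_eq u (map f s ++ r) ->
  exists2 idx : I -> nat, {in s &, injective idx} &
    {in s, forall i, (idx i < size u)%N /\ nth x0 u (idx i) = f i}.
Proof.
move=> uniq_s; rewrite perm_sym => /(perm_iotaP x0)[Is pIs fsE].
have uniq_Is : uniq Is by rewrite (perm_uniq pIs) iota_uniq.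
have size_Is : size (map f s ++ r) = size Is by rewrite fsE size_map.
have lt_Is i : i \in s -> (index i s < size Is)%N.
  by move=> i_in; rewrite -size_Is size_cat size_map ltn_addr // index_mem.
exists (fun i => nth 0%N Is (index i s)).
  move=> i j i_in j_in /eqP; rewrite nth_uniq ?lt_Is // => /eqP ij.
  by rewrite -(nth_index i i_in) ij nth_index.
move=> i i_in; split.
  have : nth 0%N Is (index i s) \in iota 0 (size u).
    by rewrite -(perm_mem pIs) mem_nth ?lt_Is.
  by rewrite mem_iota.
rewrite -(nth_map 0%N x0 (nth x0 u)) ?lt_Is // -fsE nth_cat size_map index_mem i_in.
by rewrite (nth_map i) ?index_mem // nth_index.
Qed.

Theorem proposition4p1 (R : realType) (n m : nat)
    (Mass lam : 'I_m -> R) (t : 'I_m -> nat)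
    (m_ge1 : (1 <= m)%N) (le_mn : (m <= n)%N)
    (Mass_gt0 : forall i : 'I_m, 0 < Mass i)
    (lam_gt0 : forall i : 'I_m, 0 < lam i)
    (lam_incr : forall i j : 'I_m, (i < j)%N -> lam i < lam j)
    (t_gt0 : forall i : 'I_m, (0 < t i)%N)
    (sum_t : (\sum_(i < m) t i)%N = n)
    (t_le : forall i : 'I_m, (t i <= i.+1)%N) :
  exists (mm k b : 'I_n -> R) (idx : 'I_m -> 'I_n),
    [/\ forall j : 'I_n, [/\ 0 < mm j, 0 < k j & 0 <= b j],
        injective idx,
        forall l : 'I_m, mm (idx l) = Mass l &
        \prod_(i < m) ('X - (lam i)%:P) ^+ t i %| chain_charpoly mm k b].
Proof.
pose s := eig_order t.
have mem_s i : i \in s by exact: mem_eig_order.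
have perm_s : perm_eq s (enum 'I_m) by exact: perm_eig_order.
have size_s : size s = m by exact: size_eig_order.
have uniq_s : uniq s by exact: uniq_eig_order.
have lam_inj : injective lam.
  move=> i j ij; have [/lam_incr|/lam_incr|/val_inj //] := ltngtP i j.
    by rewrite ij ltxx.
  by rewrite ij ltxx.
(* The enumeration is reversed because blocking points must decrease. *)
pose S j := [seq lam i | i <- rev (enum 'I_m) & raises t j i].
pose entry j := (lam j, Mass j, S j).
have SP j y : y \in S j -> exists2 i, raises t j i & y = lam i.
  by move=> /mapP[i]; rewrite mem_filter => /andP[ji _] ->; exists i.
have entry_s : all entry_ok (map entry s).
  apply/allP => _ /mapP[j _ ->]; rewrite /entry_ok /= lam_gt0 Mass_gt0 /=.
  apply/andP; split; last first.
    by apply/allP => y /SP[i ji ->]; exact: lam_incr (raises_lt t_gt0 t_le ji).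
  rewrite sorted_map filter_rev rev_sorted.
  apply: pairwise_sorted; apply: pairwise_filter.
  by apply: sub_pairwise pairwise_enum_ord => i i'; exact: lam_incr.
have fresh_s : pairwise fresh (map entry s).
  rewrite pairwise_map.
  have idx_s : pairwise (fun i j => (index i s < index j s)%N) s.
    apply/(pairwiseP (Ordinal m_ge1)) => p q p_s q_s pq.
    by rewrite !index_uniq.
  apply: sub_pairwise idx_s => i j ij; rewrite /fresh /= inE negb_or.
  apply/andP; split.
    by apply: contraTneq ij => /lam_inj ->; rewrite ltnn.
  apply/negP => /SP[i' /andP[_ ji'] /lam_inj ii'].
  by have := ltn_trans ij ji'; rewrite ii' ltnn.
have [s0 [z sE]] : exists s0 z, s = rcons s0 z.
  have := size_s; case: (lastP s) => [m0|s0 z _]; last by exists s0, z.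
  by move: m_ge1; rewrite -m0.
have size_s0 : size s0 = m.-1 by move: size_s; rewrite sE size_rcons; lia.
have index_s0 p : (p < m.-1)%N -> index (nth z s0 p) s = p.
  move=> p_lt; have -> : nth z s0 p = nth z s p by rewrite sE nth_rcons size_s0 p_lt.
  by rewrite index_uniq // size_s; lia.
have index_z : index z s = m.-1.
  by rewrite sE -cats1 index_cat /= eqxx addn0 size_s0 ifN //; move: uniq_s; rewrite sE rcons_uniq => /andP[].
have S_z : S z = [::].
  apply/eqP; rewrite -size_eq0 -leqn0 leqNgt; apply/negP => S_z.
  have [i /andP[_ zi] _] := SP z _ (mem_nth 0 S_z).
  by have := pos_lt t i; rewrite -/s in zi *; move: zi; rewrite index_z; lia.
have sorted_s0 : sorted (fun e e' => (e.2 != [::]) ==> (e'.2 != [::])) (map entry s0).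
  rewrite sorted_map; apply/(sortedP z) => p; rewrite size_s0 => p_lt.
  apply/implyP; rewrite /= => Sp.
  have : (0 < size (S (nth z s0 p)))%N by rewrite lt0n size_eq0.
  move=> /(mem_nth 0)/SP[i pi _].
  have [||i' pi'] := @raises_next m t t_gt0 _ (nth z s0 p.+1) i pi.
  - by rewrite -/s !index_s0 //; lia.
  - by rewrite -/s index_s0.
  have : lam i' \in S (nth z s0 p.+1).
    by apply: map_f; rewrite mem_filter pi' mem_rev mem_enum.
  by case: (S _).
rewrite sE map_rcons in entry_s fresh_s.
have [L [r [c [admL szL pL tL]]]] := schedule_chain entry_s fresh_s sorted_s0 S_z.
rewrite -!map_rcons -sE in szL pL tL.
have count_s i : count (raises t ^~ i) s = (t i).-1.
  by rewrite (permP perm_s) count_raises.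
(* Each level contributes one element plus one per raised eigenvalue; exchanging sums, the total is
   m plus the sum of t i - 1. *)
have size_L : size L = n.
  rewrite szL big_map -sum_t.
  under eq_bigr do rewrite /= size_map size_filter count_rev -add1n -sum1_count big_mkcond.
  rewrite big_split sum1_size exchange_big /= size_s.
  under eq_bigr do rewrite -big_mkcond sum1_count count_s.
  rewrite big_enum /= -[X in (X + _)%N](card_ord m) -sum1_card -big_split /=.
  by apply: eq_bigr => i _; rewrite add1n prednK.
rewrite -size_L.
have charE : (transfer L).1 =
    c *: \prod_(i < m) ((lam i)%:P - 'X) ^+ t i.
  rewrite tL /spectrum /raised !big_map; congr (_ *: _) => /=.
  under [X in _ * X]eq_bigr do
    rewrite big_map big_filter (perm_big (enum 'I_m)) ?perm_rev //.
  rewrite prod_filter_count (perm_big _ perm_s) /= -big_split big_enum /=.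
  by apply: eq_bigr => i _; rewrite count_s -exprS prednK.
pose x (i : 'I_(size L)) := nth (0, 0, 0) L i.
have [idx idx_inj idxP] : exists2 idx : 'I_m -> nat, {in rev s &, injective idx} &
    {in rev s, forall i, (idx i < size [seq mass u | u <- L])%N /\
       nth 0 [seq mass u | u <- L] (idx i) = Mass i}.
  apply: (@perm_cat_choice _ 0 _ Mass (rev s) r); first by rewrite rev_uniq.
  by move: pL; rewrite -map_comp -map_rev.
have mem_rs i : i \in rev s by rewrite mem_rev.
have idx_lt i : (idx i < size L)%N by have [] := idxP i (mem_rs i); rewrite size_map.
exists (fun i => mass (x i)), (fun i => (x i).1.2), (fun i => (x i).2).
exists (fun i => Ordinal (idx_lt i)); split.
- move=> j; have := allP admL (x j) (mem_nth _ (ltn_ord j)).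
  by move=> /and3P[].
- by move=> i j [] /idx_inj; apply.
- move=> l; rewrite /x /=; have [_ <-] := idxP l (mem_rs l).
  by rewrite (nth_map (0, 0, 0)).
rewrite chain_charpolyE charE -mul_polyC; apply: dvdp_mull.
have -> : \prod_(i < m) ((lam i)%:P - 'X) ^+ t i =
    (\prod_(i < m) (-1) ^+ t i) * \prod_(i < m) ('X - (lam i)%:P) ^+ t i :> {poly R}.
  by rewrite -big_split /=; apply: eq_bigr => i _; rewrite -exprNn opprB.
exact: dvdp_mull.
Qed.
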